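(* Let $(Q,\rho)$ be a quiver with relations such that $A=KQ/\langle\rho\rangle$ is a split basic self-injective finite dimensional algebra. The following assertions hold: 1. If $(\tilde Q,\tilde\rho)\longrightarrow(Q,\rho)$ is the universal covering, then $\tilde A=K\tilde Q/\langle\tilde\rho\rangle$ is a pseudo-Frobenius algebra with enough idempotents. 2. If $(Q',\rho')\longrightarrow(Q,\rho)$ is a covering of quivers with relations such that $A'=KQ'/\langle\rho'\rangle$ is finite dimensional, then $A'$ is a self-injective algebra.
   Context: $K$ is a fixed field. For a quiver $Q$ with vertex set $Q_0$, $KQ$ is its path algebra (with enough idempotents $e_i$, $i\in Q_0$). A quiver with relations $(Q,\rho)$ consists of a quiver $Q$ and a set $\rho\subset\bigcup_{i,j\in Q_0}e_iKQe_j$ of linear combinations of parallel paths of length $\ge 2$; $\langle\rho\rangle$ is the two-sided ideal generated by $\rho$, and $KQ/\langle\rho\rangle$ is an algebra with enough idempotents given by the vertices (equivalently a small $K$-category). All algebras here are trivially graded (grading group $H=0$). Here $A$ split basic means that, for the vertex idempotents, $e_iAe_i$ is local with residue algebra $K$ for each $i$, and $e_iAe_j\subseteq J(A)$ for $i\ne j$, where $J(A)$ is the Jacobson radical. A *covering of quivers with relations* $F:(Q',\rho')\to(Q,\rho)$ is a morphism of graphs with relations in the sense of E. L. Green; it is such that there is a group $G$ of automorphisms of $(Q',\rho')$ for which, putting $A'=KQ'/\langle\rho'\rangle$ and $A=KQ/\langle\rho\rangle$, $G$ acts on $A'$ by automorphisms permuting the vertex idempotents and acting freely on them ($g(i)\neq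 i$ for every vertex $i$ and $g\neq 1$), and $F$ induces a covering of $K$-categories $A'\stackrel{\pi}{\to}A'/G\stackrel{\cong}{\to}A$. Here $A'/G$ is the orbit category: its objects are the $G$-orbits $[i]$ of vertices, $e_{[i]}(A'/G)e_{[j]}=\oplus_{g\in G}e_iA'e_{g(j)}$, whose elements are written as formal sums of orbits $[a]$ of elements $a\in e_iA'e_{g(j)}$, and $[a][b]=[ab^g]$ if $a\in e_kA'e_l$, $b\in e_{k'}A'e_{l'}$ and $g\in G$ is the unique element with $g(k')=l$ (and $[a][b]=0$ if no such $g$ exists); $\pi$ maps $a\mapsto[a]$. The *universal covering* of $(Q,\rho)$ is a covering $\tilde F:(\tilde Q,\tilde\rho)\to(Q,\rho)$ such that for any covering $F:(Q',\rho')\to(Q,\rho)$ there is a unique covering $F':(\tilde Q,\tilde\rho)\to(Q',\rho')$ with $F\circ F'=\tilde F$; it exists for any quiver with relations. *Pseudo-Frobenius* (ungraded case $H=0$): let $B$ be an algebra with distinguished family of nonzero orthogonal idempotents $(e_i)_{i\in I}$ ($B=\oplus e_iB=\oplus Be_i$), with all $e_iBe_j$ finite dimensional, which is weakly basic, i.e. each $e_iBe_i$ is local and $e_iBe_j$ is contained in the Jacobson radical of $B$ for $i\ne j$. $B$ is pseudo-Frobenius if it admits a Nakayama form, i.e. a bilinear form $(-,-):B\times B\to K$ with $(ab,c)=(a,bc)$ for all $a,b,c$, such that for each $i\in I$ there is a unique $\nu(i)\in I$ with $(e_iB,Be_{\nu(i)})\ne 0$, $\nu:I\to I$ is bijective,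 and for all $i,j\in I$ the induced form $e_iBe_j\times e_jBe_{\nu(i)}\to K$ is nondegenerate. Equivalently, the finitely generated projective and the finitely cogenerated injective unital left (resp. right) $B$-modules coincide.
   Formalization: The universal covering is taken with base points and among coverings having exactly one connected component above each component of Q; without base points and connectedness the stated universal property is satisfied by no covering of a nonempty quiver. *)

(* Defs.v *)
From HB Require Import structures.
From mathcomp Require Import all_boot all_algebra finmap.
From mathcomp Require Import generic_quotient ring_quotient monalg.
From mathcomp Require Import boolp classical_sets functions cardinality fsbigop.

Set Implicit Arguments.
Unset Strict Implicit.
Unset Printing Implicit Defensive.
Import GRing.Theory.
Local Open Scope ring_scope.
Local Open Scope quotient_scope.
Local Open Scope classical_set_scope.

Definition subspace (K : fieldType) (V : lmodType K) (S : set V) : Prop :=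
  [/\ S 0, (forall x y, S x -> S y -> S (x + y))
    & (forall (c : K) x, S x -> S (c *: x))].

Record submod (K : fieldType) (V : lmodType K) := Submod {
  submod_set : set V;
  submodP : subspace submod_set }.

Lemma span_subspace (K : fieldType) (V : lmodType K) (X : set V) :
  subspace [set x | forall S : set V, subspace S -> X `<=` S -> S x].
Proof.
split=> [S [] //|x y Sx Sy S sS XS|c x Sx S sS XS].
  by have [_ + _] := sS; apply; [exact: Sx | exact: Sy].
by have [_ _ +] := sS; apply; exact: Sx.
Qed.

Definition span (K : fieldType) (V : lmodType K) (X : set V) : submod V :=
  Submod (span_subspace X).

Definition fin_spanned (K : fieldType) (V : lmodType K) (P : set V) : Prop :=
  exists s : seq V, forall x, P x ->
    exists c : nat -> K, x = \sum_(k < size s) c k *: s`_k.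

Section QuotientSpace.
Variables (K : fieldType) (V : lmodType K) (S : submod V).

Definition submod_pred : V -> bool := fun x => `[< submod_set S x >].

Lemma submod_zmod_closed : zmod_closed submod_pred.
Proof.
have [S0 SD SZ] := submodP S.
split; first exact/asboolP.
move=> x y /asboolP Sx /asboolP Sy; apply/asboolP/SD => //.
by rewrite -scaleN1r; exact: SZ.
Qed.
HB.instance Definition _ :=
  GRing.isZmodClosed.Build V submod_pred submod_zmod_closed.

Definition submod_zmodClosed : zmodClosed V :=
  GRing.ZmodClosed.clone V submod_pred _.

Definition qspace : Type := Quotient.quot submod_zmodClosed.
HB.instance Definition _ := ZmodQuotient.on qspace.

Definition qproj (x : V) : qspace := \pi_(Quotient.quot submod_zmodClosed) x.
Definition qrepr (x : qspace) : V := repr (x : Quotient.quot submod_zmodClosed).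

Lemma qreprK (x : qspace) : qproj (qrepr x) = x.
Proof. exact: reprK. Qed.

Lemma qprojP (x y : V) : qproj x = qproj y <-> submod_set S (x - y).
Proof.
split=> [/eqP|h]; first by rewrite -Quotient.idealrBE => /asboolP.
by apply/eqP; rewrite -Quotient.idealrBE; apply/asboolP.
Qed.

Lemma qprojD x y : qproj (x + y) = qproj x + qproj y.
Proof. exact: pi_addr. Qed.

Definition qscale (c : K) (x : qspace) : qspace := qproj (c *: qrepr x).

Lemma qscale_proj c x : qscale c (qproj x) = qproj (c *: x).
Proof.
apply/qprojP; rewrite -scalerBr; have [_ _] := submodP S; apply.
by apply/qprojP; rewrite qreprK.
Qed.

Lemma qscaleA a b x : qscale a (qscale b x) = qscale (a * b) x.
Proof. by rewrite -[x]qreprK !qscale_proj scalerA. Qed.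
Lemma qscale1 : left_id 1 qscale.
Proof. by move=> x; rewrite -[x]qreprK !qscale_proj scale1r. Qed.
Lemma qscaleDr : right_distributive qscale +%R.
Proof.
move=> c x y; rewrite -[x]qreprK -[y]qreprK -qprojD !qscale_proj -qprojD.
by rewrite scalerDr.
Qed.
Lemma qscaleDl x : {morph qscale^~ x : a b / a + b}.
Proof.
move=> a b; rewrite -[x]qreprK !qscale_proj -qprojD.
by rewrite scalerDl.
Qed.
HB.instance Definition _ := GRing.Zmodule_isLmodule.Build K qspace
  qscaleA qscale1 qscaleDr qscaleDl.

Lemma qproj_is_linear : linear qproj.
Proof. by move=> c x y; rewrite qprojD -qscale_proj. Qed.
HB.instance Definition _ :=
  GRing.isLinear.Build K V qspace *:%R qproj qproj_is_linear.

End QuotientSpace.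

(* Possibly non-unital associative K-algebras A = (+)_i e_i A = (+)_i A e_i;
   the sums are automatically direct, the e_i being orthogonal. *)
Record ealgebra (K : fieldType) := EAlgebra {
  ecar :> lmodType K;
  eidx : choiceType;
  emul : ecar -> ecar -> ecar;
  eid : eidx -> ecar;
  emulA : associative emul;
  emul_linl : forall b, linear (emul^~ b);
  emul_linr : forall a, linear (emul a);
  eid_neq0 : forall i, eid i != 0;
  eid_orth : forall i j, emul (eid i) (eid j) = if i == j then eid i else 0;
  eid_suml : forall a,
    exists2 s : seq eidx, uniq s & a = \sum_(i <- s) emul (eid i) a;
  eid_sumr : forall a,
    exists2 s : seq eidx, uniq s & a = \sum_(i <- s) emul a (eid i) }.

Arguments eid {K e} _.
Arguments emul {K e} _ _.
Notation "a ** b" := (emul a b) (at level 40, left associativity).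

Section EAlgebraTheory.
Variables (K : fieldType) (A : ealgebra K).
Implicit Types (i j : eidx A) (a b : A) (I : set A).

(* x in e_i A is expressed as e_i x = x, and likewise on the right. *)
Definition left_corner i : set A := [set a | eid i ** a = a].
Definition right_corner j : set A := [set a | a ** eid j = a].
Definition corner i j : set A := left_corner i `&` right_corner j.

Definition fin_dim : Prop := fin_spanned [set: A].
Definition locally_fin_dim : Prop := forall i j, fin_spanned (corner i j).

Definition right_ideal I : Prop :=
  subspace I /\ forall x a, I x -> I (x ** a).

Definition maximal_right_ideal I : Prop :=
  [/\ right_ideal I, I <> [set: A]
    & forall J, right_ideal J -> I `<=` J -> J = I \/ J = [set: A]].

Definition jacobson : set A :=
  [set a | forall I, maximal_right_ideal I -> I a].

Definition two_sided_ideal I : Prop :=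
  subspace I /\ forall x a, I x -> I (a ** x) /\ I (x ** a).

Definition corner_unit i : set A :=
  [set a | exists2 b, corner i i b & a ** b = eid i /\ b ** a = eid i].

(* e_i A e_i is local: its non-units are closed under addition; they then
   form the unique maximal (left, right) ideal of e_i A e_i. *)
Definition local_corner i : Prop := forall a b,
  corner i i a -> corner i i b -> ~ corner_unit i a -> ~ corner_unit i b ->
  ~ corner_unit i (a + b).

(* K -> e_i A e_i / {non-units} is onto. *)
Definition residue_K i : Prop := forall a, corner i i a ->
  exists c : K, ~ corner_unit i (a - c *: eid i).

Definition weakly_basic : Prop :=
  (forall i, local_corner i) /\
  (forall i j, i <> j -> corner i j `<=` jacobson).

Definition split_basic : Prop :=
  [/\ forall i, local_corner i, forall i, residue_K i
    & forall i j, i <> j -> corner i j `<=` jacobson].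

Definition nakayama_form (f : A -> A -> K) (nu : eidx A -> eidx A) : Prop :=
  [/\ (forall b, linear_for *%R (f^~ b)) /\ (forall a, linear_for *%R (f a)),
      forall a b c, f (a ** b) c = f a (b ** c),
      forall i k, (exists a b, [/\ left_corner i a, right_corner k b
                                 & f a b != 0]) <-> k = nu i,
      bijective nu
    & forall i j,
        (forall a, corner i j a ->
           (forall b, corner j (nu i) b -> f a b = 0) -> a = 0) /\
        (forall b, corner j (nu i) b ->
           (forall a, corner i j a -> f a b = 0) -> b = 0)].

Definition pseudo_frobenius : Prop :=
  [/\ locally_fin_dim, weakly_basic & exists f nu, nakayama_form f nu].

End EAlgebraTheory.

Arguments fin_dim {K} A.
Arguments split_basic {K} A.
Arguments weakly_basic {K} A.
Arguments pseudo_frobenius {K} A.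

Record rmodule (K : fieldType) (A : ealgebra K) := RModule {
  rcar :> lmodType K;
  ract : rcar -> A -> rcar;
  ract_linl : forall a, linear (ract^~ a);
  ract_linr : forall m, linear (ract m);
  ractA : forall m a b, ract (ract m a) b = ract m (a ** b);
  ract_unital : forall m,
    exists2 s : seq (eidx A), uniq s & m = \sum_(i <- s) ract m (eid i) }.

Arguments ract {K A r} _ _.

Definition rhom (K : fieldType) (A : ealgebra K) (M N : rmodule A)
    (f : M -> N) : Prop :=
  linear f /\ forall m a, f (ract m a) = ract (f m) a.

Definition injective_module (K : fieldType) (A : ealgebra K) (E : rmodule A)
    : Prop :=
  forall (M N : rmodule A) (u : M -> N) (f : M -> E),
    rhom u -> injective u -> rhom f ->
    exists2 g : N -> E, rhom g & forall m, g (u m) = f m.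

Definition regular_module (K : fieldType) (A : ealgebra K) : rmodule A :=
  RModule (@emul_linl K A) (@emul_linr K A)
    (fun m a b => esym (emulA m a b)) (@eid_sumr K A).

Definition self_injective (K : fieldType) (A : ealgebra K) : Prop :=
  injective_module (regular_module A).

Section QuotientAlgebra.
Variables (K : fieldType) (A : ealgebra K) (I : submod A).
Hypothesis I_ideal : two_sided_ideal (submod_set I).
Hypothesis I_eid : forall i : eidx A, ~ submod_set I (eid i).

Definition qmul (x y : qspace I) : qspace I :=
  qproj I (qrepr x ** qrepr y).

Definition qeid (i : eidx A) : qspace I := qproj I (eid i).

Let emulBl (a b c : A) : (a - b) ** c = a ** c - b ** c.
Proof.
rewrite -scaleN1r [_ + _]addrC (emul_linl c (-1) b a) scaleN1r.
by rewrite addrC.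
Qed.
Let emulBr (a b c : A) : c ** (a - b) = c ** a - c ** b.
Proof.
rewrite -scaleN1r [_ + _]addrC (emul_linr c (-1) b a) scaleN1r.
by rewrite addrC.
Qed.

Lemma qmul_proj a b : qmul (qproj I a) (qproj I b) = qproj I (a ** b).
Proof.
have [[_ ID _] IM] := I_ideal; apply/qprojP.
have Ia : submod_set I (qrepr (qproj I a) - a) by apply/qprojP; rewrite qreprK.
have Ib : submod_set I (qrepr (qproj I b) - b) by apply/qprojP; rewrite qreprK.
have -> : qrepr (qproj I a) ** qrepr (qproj I b) - a ** b =
  (qrepr (qproj I a) - a) ** qrepr (qproj I b) +
  a ** (qrepr (qproj I b) - b).
  by rewrite emulBl emulBr addrA subrK.
by apply: ID; [case: (IM _ (qrepr (qproj I b)) Ia) | case: (IM _ a Ib)].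
Qed.

Lemma qmulA : associative qmul.
Proof.
by move=> x y z; rewrite -[x]qreprK -[y]qreprK -[z]qreprK !qmul_proj emulA.
Qed.

Lemma qmul_linl y : linear (qmul^~ y).
Proof.
move=> c x1 x2 /=; rewrite -[x1]qreprK -[x2]qreprK -[y]qreprK !qmul_proj.
by rewrite -!(linearP (qproj I)) /= !qmul_proj emul_linl.
Qed.

Lemma qmul_linr x : linear (qmul x).
Proof.
move=> c y1 y2 /=; rewrite -[y1]qreprK -[y2]qreprK -[x]qreprK !qmul_proj.
by rewrite -!(linearP (qproj I)) /= !qmul_proj emul_linr.
Qed.

Lemma qeid_neq0 i : qeid i != 0.
Proof.
apply/eqP; rewrite -[RHS](linear0 (qproj I)) => /qprojP; rewrite subr0.
exact: I_eid.
Qed.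

Lemma qeid_orth i j : qmul (qeid i) (qeid j) = if i == j then qeid i else 0.
Proof. by rewrite qmul_proj eid_orth; case: eqP => // _; rewrite linear0. Qed.

Lemma qeid_suml x :
  exists2 s : seq (eidx A), uniq s & x = \sum_(i <- s) qmul (qeid i) x.
Proof.
have [s s_uniq xE] := eid_suml (qrepr x); exists s => //.
rewrite -[LHS]qreprK {1}xE linear_sum; apply: eq_bigr => i _ /=.
by rewrite -qmul_proj qreprK.
Qed.

Lemma qeid_sumr x :
  exists2 s : seq (eidx A), uniq s & x = \sum_(i <- s) qmul x (qeid i).
Proof.
have [s s_uniq xE] := eid_sumr (qrepr x); exists s => //.
rewrite -[LHS]qreprK {1}xE linear_sum; apply: eq_bigr => i _ /=.
by rewrite -qmul_proj qreprK.
Qed.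

Definition quotient_ealgebra : ealgebra K :=
  EAlgebra qmulA qmul_linl qmul_linr qeid_neq0 qeid_orth qeid_suml qeid_sumr.

End QuotientAlgebra.

Lemma gen_ideal_ideal (K : fieldType) (A : ealgebra K) (X : set A) :
  two_sided_ideal
    [set x | forall I : set A, two_sided_ideal I -> X `<=` I -> I x].
Proof.
split; first split.
- by move=> I [[]].
- move=> x y Ix Iy I idI XI; have [[_ + _] _] := idI.
  by apply; [exact: Ix | exact: Iy].
- move=> c x Ix I idI XI; have [[_ _ +] _] := idI; apply; exact: Ix.
move=> x a Ix; split=> I idI XI.
  by have [_ /(_ x a (Ix I idI XI))[]] := idI.
by have [_ /(_ x a (Ix I idI XI))[]] := idI.
Qed.

Definition gen_ideal (K : fieldType) (A : ealgebra K) (X : set A) : submod A :=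
  Submod (proj1 (gen_ideal_ideal X)).

Record quiver := Quiver {
  vert : choiceType;
  arr : choiceType;
  src : arr -> vert;
  tgt : arr -> vert }.

Section Paths.
Variable Q : quiver.

Fixpoint composable (v : vert Q) (s : seq (arr Q)) : bool :=
  if s is a :: s' then (src a == v) && composable (tgt a) s' else true.

(* Paths are read from left to right; the source is recorded in order to have
   a trivial path at each vertex. *)
Record qpath := QPath {
  qpath_val : vert Q * seq (arr Q);
  qpathP : composable qpath_val.1 qpath_val.2 }.
HB.instance Definition _ := [isSub for qpath_val].
HB.instance Definition _ := [Choice of qpath by <:].

Definition psrc (p : qpath) : vert Q := (qpath_val p).1.
Definition parrs (p : qpath) : seq (arr Q) := (qpath_val p).2.
Definition ptgt (p : qpath) : vert Q :=
  last (psrc p) [seq tgt a | a <- parrs p].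
Definition plen (p : qpath) : nat := size (parrs p).

Definition triv (v : vert Q) : qpath := @QPath (v, [::]) isT.

(* [insub] succeeds whenever the endpoints match, by [pcat_composable] *)
Definition pcat (p q : qpath) : option qpath :=
  if ptgt p == psrc q then insub (psrc p, parrs p ++ parrs q) else None.

Lemma composable_cat v s1 s2 : composable v (s1 ++ s2) =
  composable v s1 && composable (last v [seq tgt a | a <- s1]) s2.
Proof. by elim: s1 v => //= a s1 IH v; rewrite IH andbA. Qed.

Lemma pcat_composable p q : ptgt p = psrc q ->
  composable (psrc p) (parrs p ++ parrs q).
Proof.
move=> pq; rewrite composable_cat; apply/andP; split; first exact: qpathP.
by rewrite -/(ptgt p) pq; exact: qpathP.
Qed.

Variant pcat_spec p q : option qpath -> bool -> Prop :=
| PcatSome r of ptgt p = psrc q & psrc r = psrc p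
    & parrs r = parrs p ++ parrs q : pcat_spec p q (Some r) true
| PcatNone of ptgt p <> psrc q : pcat_spec p q None false.

Lemma pcatP p q : pcat_spec p q (pcat p q) (ptgt p == psrc q).
Proof.
rewrite /pcat; case: eqP => [pq|]; last by constructor.
by rewrite (insubT (fun x => composable x.1 x.2)
  (x := (psrc p, parrs p ++ parrs q)) (pcat_composable pq)); constructor.
Qed.

Lemma qpath_inj p q : psrc p = psrc q -> parrs p = parrs q -> p = q.
Proof.
by case: p q => -[v s] vs [[w t] wt]; rewrite /psrc /parrs /= => ? ?;
  apply/val_inj => /=; congr pair.
Qed.

Lemma ptgt_pcat p q r : ptgt p = psrc q -> psrc r = psrc p ->
  parrs r = parrs p ++ parrs q -> ptgt r = ptgt q.
Proof.
move=> pq rp rs; rewrite /ptgt rp rs map_cat last_cat.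
by rewrite -/(ptgt p) pq.
Qed.

End Paths.

Definition lin_ext (K : fieldType) (T : choiceType) (V : lmodType K)
    (f : T -> V) (x : {malg K[T]}) : V :=
  \sum_(k <- msupp x) x@_k *: f k.

Section LinExt.
Variables (K : fieldType) (T : choiceType).
Local Open Scope fset_scope.

Lemma lin_extEw (V : lmodType K) (f : T -> V) (x : {malg K[T]}) (D : {fset T}) :
  msupp x `<=` D -> lin_ext f x = \sum_(k <- D) x@_k *: f k.
Proof.
move=> xD; rewrite /lin_ext (big_fset_incl _ xD) // => k _ kx.
by rewrite mcoeff_outdom // scale0r.
Qed.

Lemma lin_ext_is_linear (V : lmodType K) (f : T -> V) : linear (lin_ext f).
Proof.
move=> c x y; pose D := msupp (c *: x + y) `|` (msupp x `|` msupp y).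
have sub : [/\ msupp (c *: x + y) `<=` D, msupp x `<=` D & msupp y `<=` D].
  split; first exact: fsubsetUl.
    by apply: fsubset_trans (fsubsetUr _ _); exact: fsubsetUl.
  by apply: fsubset_trans (fsubsetUr _ _); exact: fsubsetUr.
have [s1 s2 s3] := sub.
rewrite (lin_extEw _ s1) (lin_extEw _ s2) (lin_extEw _ s3).
rewrite scaler_sumr -big_split; apply: eq_bigr => k _ /=.
by rewrite mcoeffD mcoeffZ scalerDl scalerA.
Qed.
HB.instance Definition _ (V : lmodType K) (f : T -> V) :=
  GRing.isLinear.Build K {malg K[T]} V *:%R (lin_ext f) (lin_ext_is_linear f).

Lemma lin_extU (V : lmodType K) (f : T -> V) k : lin_ext f << k >> = f k.
Proof.
rewrite (@lin_extEw _ _ _ [fset k]) ?msuppU_le //.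
by rewrite big_seq_fset1 mcoeffUU scale1r.
Qed.

Lemma lin_ext_id (x : {malg K[T]}) : lin_ext (fun k => << k >>) x = x.
Proof.
rewrite [RHS]monalgE; apply: eq_bigr => k _; apply/malgP => k'.
by rewrite mcoeffZ !mcoeffU mulrnAr mulr1.
Qed.

Lemma malg_eq_lin (V : lmodType K) (f g : {malg K[T]} -> V) :
  linear f -> linear g -> (forall k, f << k >> = g << k >>) -> f =1 g.
Proof.
move=> lf lg fg x; rewrite -(lin_ext_id x) /lin_ext.
have sumE (h : {malg K[T]} -> V) (s : seq T) : linear h ->
    h (\sum_(k <- s) x@_k *: << k >>) = \sum_(k <- s) x@_k *: h << k >>.
  move=> lh; have h0 : h 0 = 0.
    by have := lh (-1) 0 0; rewrite scaleN1r oppr0 addr0 scaleN1r addNr.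
  elim: s => [|k s IH]; first by rewrite !big_nil.
  by rewrite !big_cons lh IH.
by rewrite !sumE //; apply: eq_bigr => k _; rewrite fg.
Qed.

End LinExt.

Section PathAlgebra.
Variables (K : fieldType) (Q : quiver).
Local Notation KQ := {malg K[qpath Q]}.
Implicit Types (p q r : qpath Q) (x y z : KQ) (u v w : vert Q).

Definition pmul p q : KQ := if pcat p q is Some r then << r >> else 0.

Definition kqmul x y : KQ := lin_ext (fun p => lin_ext (pmul p) y) x.

Lemma kqmul_linl y : linear (kqmul^~ y).
Proof. exact: lin_ext_is_linear. Qed.

Lemma kqmul_linr x : linear (kqmul x).
Proof.
move=> c y z; rewrite /kqmul /lin_ext scaler_sumr -big_split.
apply: eq_bigr => p _ /=; rewrite -!/(lin_ext _ _) linearP scalerDr !scalerA.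
by rewrite mulrC.
Qed.

Lemma kqmulU p q : kqmul << p >> << q >> = pmul p q.
Proof. by rewrite /kqmul !lin_extU. Qed.

Lemma kqmul0l y : kqmul 0 y = 0.
Proof. exact: (linear0 (lin_ext _)). Qed.

Lemma kqmul0r x : kqmul x 0 = 0.
Proof.
have := kqmul_linr x (-1) 0 0.
by rewrite scaleN1r oppr0 addr0 scaleN1r addNr.
Qed.

Lemma pmulA p q r : kqmul << p >> (pmul q r) = kqmul (pmul p q) << r >>.
Proof.
rewrite /pmul; case: pcatP => [s qr sq sE|qr]; case: pcatP => [t pq tp tE|pq].
- rewrite !kqmulU /pmul; case: pcatP => [a ps ap aE|]; last by rewrite sq.
  case: pcatP => [b tr bt bE|]; last by rewrite (ptgt_pcat pq tp tE).
  congr << _ >>; apply: qpath_inj; first by rewrite ap bt tp.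
  by rewrite aE bE tE sE catA.
- rewrite kqmulU /pmul kqmul0l; case: pcatP => // a ps; by rewrite -sq in pq.
- rewrite kqmulU /pmul kqmul0r; case: pcatP => // a tr.
  by rewrite (ptgt_pcat pq tp tE) in tr.
- by rewrite kqmul0l kqmul0r.
Qed.

Lemma kqmulA : associative kqmul.
Proof.
move=> x y z.
apply: (malg_eq_lin (f := fun x => kqmul x (kqmul y z))
  (g := fun x => kqmul (kqmul x y) z)).
- by move=> c a b; rewrite (kqmul_linl _ c a b).
- move=> c a b; rewrite (kqmul_linl y c a b).
  by rewrite (kqmul_linl z c (kqmul a y) (kqmul b y)).
move=> p {x}.
apply: (malg_eq_lin (f := fun y => kqmul << p >> (kqmul y z))
  (g := fun y => kqmul (kqmul << p >> y) z)).
- by move=> c a b; rewrite (kqmul_linl z c a b) kqmul_linr.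
- by move=> c a b; rewrite kqmul_linr (kqmul_linl z c).
move=> q {y}.
apply: (malg_eq_lin (f := fun z => kqmul << p >> (kqmul << q >> z))
  (g := fun z => kqmul (kqmul << p >> << q >>) z)).
- by move=> c a b; rewrite !kqmul_linr.
- by move=> c a b; rewrite !kqmul_linr.
by move=> r; rewrite !kqmulU pmulA.
Qed.

Definition kqid v : KQ := << triv v >>.

Lemma kqid_neq0 v : kqid v != 0.
Proof. by rewrite monalgU_eq0 oner_eq0. Qed.

Lemma pmul_trivl v p : pmul (triv v) p = if v == psrc p then << p >> else 0.
Proof.
rewrite /pmul -[v in v == _]/(ptgt (triv v)).
case: pcatP => // r; rewrite {1}/ptgt /= => vp rv rE.
by have -> : r = p by apply: qpath_inj; rewrite ?rv.
Qed.

Lemma pmul_trivr v p : pmul p (triv v) = if ptgt p == v then << p >> else 0.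
Proof.
rewrite /pmul -[v in _ == v]/(psrc (triv v)).
case: pcatP => // r vp rv rE.
by have -> : r = p by apply: qpath_inj; rewrite // rE cats0.
Qed.

Lemma kqid_orth u v : kqmul (kqid u) (kqid v) = if u == v then kqid u else 0.
Proof. by rewrite kqmulU pmul_trivr. Qed.

Lemma kqid_suml x :
  exists2 s : seq (vert Q), uniq s & x = \sum_(v <- s) kqmul (kqid v) x.
Proof.
exists (undup [seq psrc p | p <- msupp x]); first exact: undup_uniq.
rewrite -{1}[x]lin_ext_id /lin_ext.
under [RHS]eq_bigr do rewrite /kqmul lin_extU /lin_ext.
rewrite exchange_big /=; apply: eq_big_seq => p px.
rewrite -scaler_sumr; congr (_ *: _).
under eq_bigr do rewrite pmul_trivl.
rewrite -big_mkcond /= (eq_bigl (pred1 (psrc p))); last by move=> v /=.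
rewrite big_const_seq count_uniq_mem ?undup_uniq // mem_undup.
by rewrite map_f //= addr0.
Qed.

Lemma kqid_sumr x :
  exists2 s : seq (vert Q), uniq s & x = \sum_(v <- s) kqmul x (kqid v).
Proof.
exists (undup [seq ptgt p | p <- msupp x]); first exact: undup_uniq.
rewrite -{1}[x]lin_ext_id /lin_ext.
under [RHS]eq_bigr do rewrite /kqmul /lin_ext.
rewrite exchange_big /=; apply: eq_big_seq => p px.
rewrite -scaler_sumr; congr (_ *: _).
under eq_bigr do rewrite -/(lin_ext _ _) lin_extU pmul_trivr.
rewrite -big_mkcond /= (eq_bigl (pred1 (ptgt p))); last first.
  by move=> v /=; rewrite eq_sym.
rewrite big_const_seq count_uniq_mem ?undup_uniq // mem_undup.
by rewrite map_f //= addr0.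
Qed.

Definition path_algebra : ealgebra K :=
  EAlgebra kqmulA kqmul_linl kqmul_linr kqid_neq0 kqid_orth
    kqid_suml kqid_sumr.

Lemma mcoeff_pmul p q v :
  (pmul p q)@_(triv v) = << p >>@_(triv v) * (<< q >> : KQ)@_(triv v).
Proof.
rewrite !mcoeffU -natrM /pmul; case: pcatP => [r pq rp rE|pq].
  rewrite mcoeffU; congr _%:R; rewrite mulnb; congr nat_of_bool.
  apply/eqP/andP => [rv|[/eqP pv /eqP qv]]; last first.
    by apply: qpath_inj; rewrite ?rp ?rE pv ?qv.
  move: rE; rewrite rv /=; case sp: (parrs p) => //; case sq: (parrs q) => // _.
  have pv : psrc p = v by rewrite -rp rv.
  split; apply/eqP/qpath_inj => //.
  by rewrite -pq /ptgt sp.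
rewrite mcoeff0; case: eqP => [pv|]; last by rewrite mul0n.
by case: eqP => [qv|]; [rewrite pv qv in pq | rewrite muln0].
Qed.

Lemma mcoeff_kqmul x y v :
  (kqmul x y)@_(triv v) = x@_(triv v) * y@_(triv v).
Proof.
have lc (a : KQ) : linear_for *%R (fun x : KQ => x@_(triv v) * a@_(triv v)).
  by move=> c b1 b2 /=; rewrite mcoeffD mcoeffZ mulrDl mulrA.
apply: (@malg_eq_lin K _ K^o (fun x => (kqmul x y)@_(triv v))
  (fun x => x@_(triv v) * y@_(triv v))) => [c a b|c a b|p].
- by rewrite (kqmul_linl y c a b) mcoeffD mcoeffZ.
- exact: lc.
apply: (@malg_eq_lin K _ K^o (fun y => (kqmul << p >> y)@_(triv v))
  (fun y => << p >>@_(triv v) * y@_(triv v))) => [c a b|c a b|q].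
- by rewrite kqmul_linr mcoeffD mcoeffZ.
- by rewrite mulrC lc; congr (_ + _); [congr (_ *: _)|]; rewrite mulrC.
by rewrite kqmulU mcoeff_pmul.
Qed.

End PathAlgebra.

Definition is_relation (K : fieldType) (Q : quiver) (r : {malg K[qpath Q]})
    : Prop :=
  exists i j : vert Q, forall p, p \in msupp r ->
    [/\ psrc p = i, ptgt p = j & (2 <= plen p)%N].

Record rquiver (K : fieldType) := RQuiver {
  rq_quiver :> quiver;
  rels : set {malg K[qpath rq_quiver]};
  relsP : forall r, rels r -> is_relation r }.

Section BoundAlgebra.
Variables (K : fieldType) (Q : rquiver K).

Definition rel_ideal : submod (path_algebra K Q) :=
  gen_ideal (A := path_algebra K Q) (@rels K Q).

Lemma rel_ideal_ideal : two_sided_ideal (submod_set rel_ideal).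
Proof. exact: gen_ideal_ideal. Qed.

Lemma rel_ideal_eid (v : eidx (path_algebra K Q)) :
  ~ submod_set rel_ideal (eid v).
Proof.
pose I : set (path_algebra K Q) :=
  [set x | forall w, (x : {malg K[qpath Q]})@_(triv w) = 0].
move=> /(_ I) Iv; suff : (eid v : {malg K[qpath Q]})@_(triv v) = 0.
  by rewrite mcoeffUU => /eqP; rewrite oner_eq0.
apply: Iv; last first.
  move=> r /relsP[i [j rP]] w; apply: mcoeff_outdom.
  by apply/negP => /rP[_ _]; rewrite /plen.
split; first split.
- by move=> w; rewrite mcoeff0.
- by move=> x y Ix Iy w; rewrite mcoeffD Ix Iy addr0.
- by move=> c x Ix w; rewrite mcoeffZ Ix mulr0.
move=> x a Ix; split=> w; rewrite mcoeff_kqmul Ix ?mulr0 ?mul0r //.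
Qed.

Definition rq_algebra : ealgebra K :=
  quotient_ealgebra rel_ideal_ideal rel_ideal_eid.

Definition rq_proj (x : {malg K[qpath Q]}) : rq_algebra :=
  qproj rel_ideal x.
Definition rq_repr (x : rq_algebra) : {malg K[qpath Q]} := qrepr x.

End BoundAlgebra.

Arguments rq_algebra {K} Q.
Arguments rel_ideal {K} Q.

Record qmorph (Q' Q : quiver) := QMorph {
  qmv :> vert Q' -> vert Q;
  qma : arr Q' -> arr Q;
  qm_src : forall a, src (qma a) = qmv (src a);
  qm_tgt : forall a, tgt (qma a) = qmv (tgt a) }.

Definition qmorph_eq (Q' Q : quiver) (F G : qmorph Q' Q) : Prop :=
  qmv F =1 qmv G /\ qma F =1 qma G.

Definition qmorph_id (Q : quiver) : qmorph Q Q :=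
  @QMorph Q Q id id (fun _ => erefl) (fun _ => erefl).

Lemma qmorph_comp_src (Q1 Q2 Q3 : quiver) (F : qmorph Q2 Q3)
  (G : qmorph Q1 Q2) a : src (qma F (qma G a)) = F (G (src a)).
Proof. by rewrite !qm_src. Qed.
Lemma qmorph_comp_tgt (Q1 Q2 Q3 : quiver) (F : qmorph Q2 Q3)
  (G : qmorph Q1 Q2) a : tgt (qma F (qma G a)) = F (G (tgt a)).
Proof. by rewrite !qm_tgt. Qed.
Definition qmorph_comp (Q1 Q2 Q3 : quiver) (F : qmorph Q2 Q3)
    (G : qmorph Q1 Q2) : qmorph Q1 Q3 :=
  @QMorph Q1 Q3 (F \o G) (qma F \o qma G)
    (qmorph_comp_src F G) (qmorph_comp_tgt F G).

Section PathMap.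
Variables (K : fieldType) (Q' Q : quiver) (F : qmorph Q' Q).

Lemma path_map_composable (p : qpath Q') :
  composable (F (psrc p)) [seq qma F a | a <- parrs p].
Proof.
case: p => [[v s]]; rewrite /psrc /parrs /=.
elim: s v => //= a s IH v /andP[/eqP <- /IH].
by rewrite qm_src qm_tgt eqxx.
Qed.

Definition path_map (p : qpath Q') : qpath Q :=
  @QPath Q (F (psrc p), [seq qma F a | a <- parrs p]) (path_map_composable p).

Definition kq_map : {malg K[qpath Q']} -> {malg K[qpath Q]} :=
  lin_ext (fun p => << path_map p >>).

End PathMap.

(* Relations are understood up to the ideal they generate: rho' is sent into
   <rho>, rather than into the chosen generating set rho. *)
Definition rel_morph (K : fieldType) (Q' Q : rquiver K) (F : qmorph Q' Q)
    : Prop :=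
  forall r, rels r -> submod_set (rel_ideal Q) (kq_map F r).

(* The map KQ'/<rho'> -> KQ/<rho> induced by F; it does not depend on the
   representatives when F is a [rel_morph]. *)
Definition rq_map (K : fieldType) (Q' Q : rquiver K) (F : qmorph Q' Q)
    (a : rq_algebra Q') : rq_algebra Q :=
  rq_proj (kq_map F (rq_repr a)).

Section Orbit.
Variables (K : fieldType) (A : ealgebra K) (G : groupType) (act : G -> A -> A).

(* If G acts freely on the idempotents, then
     (+)_([i],[j]) e_[i](A/G)e_[j] = (+)_([i],[j]) (+)_g e_i A e_(g j)
   is the space of G-coinvariants of A, [a] being the class of a. *)
Definition orbit_space : lmodType K :=
  qspace (span [set x : A | exists g a, x = a - act g a]).

Definition orbit_class (a : A) : orbit_space := qproj _ a.

(* For a in e_k A e_l and b in e_k' A e_l' the sum has at most one nonzero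
   term [a b^g], where g k' = l. *)
Definition orbit_mul (x y : orbit_space) : orbit_space :=
  \sum_(g \in [set: G]) orbit_class (qrepr x ** act g (qrepr y)).

End Orbit.

Record free_action (K : fieldType) (G : groupType) (Q : rquiver K)
    (act : G -> qmorph Q Q) : Prop := FreeAction {
  fa_one : qmorph_eq (act 1%g) (qmorph_id Q);
  fa_mul : forall g h,
    qmorph_eq (act (g * h)%g) (qmorph_comp (act g) (act h));
  fa_rel : forall g, rel_morph (act g);
  fa_free : forall g (i : vert Q), g <> 1%g -> act g i <> i }.

Definition is_covering (K : fieldType) (Q' Q : rquiver K) (F : qmorph Q' Q)
    : Prop :=
  rel_morph F /\
  exists (G : groupType) (act : G -> qmorph Q' Q'),
    let acta := fun g => rq_map (act g) in
    [/\ free_action act,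
        (forall v : vert Q, exists i, F i = v) /\
        (forall i j, F i = F j <-> exists g, act g i = j)
      & exists phi : orbit_space acta -> rq_algebra Q,
        [/\ linear phi, bijective phi,
            forall x y, phi (orbit_mul x y) = phi x ** phi y
          & forall a, phi (orbit_class acta a) = rq_map F a]].

Inductive linked (Q : quiver) : vert Q -> vert Q -> Prop :=
| linked_refl v : linked v v
| linked_fwd v a : linked v (src a) -> linked v (tgt a)
| linked_bwd v a : linked v (tgt a) -> linked v (src a).

(* Above each connected component of Q there is a single component of Q' (for
   connected Q: Q' is connected). *)
Definition connected_over (Q' Q : quiver) (F : qmorph Q' Q) : Prop :=
  forall i j, linked (F i) (F j) -> linked i j.

Definition base_points (Q : quiver) (B : set (vert Q)) : Prop :=
  forall i, exists! j, B j /\ linked i j.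

(* The uniqueness of F' requires base points, as F' can be composed with the
   automorphisms of Qt over Q. *)
Definition is_universal_covering (K : fieldType) (Qt Q : rquiver K)
    (Ft : qmorph Qt Q) : Prop :=
  [/\ is_covering Ft, connected_over Ft
    & forall (Q' : rquiver K) (F : qmorph Q' Q),
      is_covering F -> connected_over F ->
      forall (B : set (vert Qt)) (b : vert Qt -> vert Q'),
        base_points B -> (forall i, B i -> F (b i) = Ft i) ->
        let lifts (F' : qmorph Qt Q') :=
          [/\ is_covering F', qmorph_eq (qmorph_comp F F') Ft
            & forall i, B i -> F' i = b i] in
        exists2 F', lifts F' & forall F'', lifts F'' -> qmorph_eq F'' F'].

(* Main.v *)
From mathcomp Require Import all_boot all_algebra finmap.
From mathcomp Require Import monalg.
From mathcomp Require Import boolp classical_sets.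
Require Import Defs.

(** Only two features of a covering [A' -> A] matter: it maps each [e_i A']
    bijectively onto [e_(F i) A], and the deck transformations act simply
    transitively on the fibres of [F]. Both come from the isomorphism of [A]
    with the orbit category ([covering_functor_of_quivers]); for the first one,
    summing the translates of an element that start at [i] gives a map on
    orbits which inverts the inclusion of [e_i A'] ([orbit_section]).

    The coefficients of the trivial paths are characters [eps i] of [A] and of
    [A']. Since the corners [e_i A e_i] are local, an element of [e_i A e_i] is
    invertible unless [eps i] kills it, and this property lifts to [A']. It
    replaces all arguments about radicals: a nonzero vector starting or ending
    at [i] is never fixed by an element killed by [eps i].

    In [A], the modules [e_v A] are injective and indecomposable, so each has a
    simple socle [K w_v] with [w_v] in [e_v A e_(nu v)], and [nu] is a
    permutation. Injectivity, used for cyclic modules [b A], also makes [w_v] a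
    left multiple of every nonzero [b] in a corner ending at [nu v]
    ([self_injective_nakayama_socle]). Let [w'_i] be the preimage of [w_(F i)]
    in [e_i A']. A socle vector of [e_i A'] exists, as [e_i A'] is
    finite-dimensional, and is mapped to the line of [w_(F i)]; therefore
    [w'_i] is a socle vector and ends at a single idempotent [nu' i]. The map
    [nu'] lifts [nu] and commutes with the deck transformations, hence is
    bijective, and the multiples of elements of [A] that give [w_v] lift to
    multiples of elements of [A'] that give [w'_i]. So a functional that is 1
    on [w_(F i)], evaluated on the part of [a b] in [e_i A' e_(nu' i)] and
    summed over [i], is a Nakayama form on [A']
    ([covering_pseudo_frobenius]). This applies to every covering, the
    universal one in particular.

    If [A'] is moreover finite-dimensional, its Nakayama form identifies the
    right module [A'] with the linear dual of the left module [A'].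
    Homomorphisms from [M] to this dual are linear functionals on [M], which
    extend to every larger space ([nakayama_self_injective]). *)

Set Implicit Arguments.
Unset Strict Implicit.
Unset Printing Implicit Defensive.
Import GRing.Theory.
Local Open Scope ring_scope.

(** * Linear algebra *)

Section LinearMaps.
Variables (K : fieldType) (V W : lmodType K) (f : V -> W).
Hypothesis lf : linear f.

Lemma lin0 : f 0 = 0.
Proof. by have := lf (-1) 0 0; rewrite scaleN1r oppr0 addr0 scaleN1r addNr. Qed.

Lemma linD x y : f (x + y) = f x + f y.
Proof. by have := lf 1 x y; rewrite !scale1r. Qed.

Lemma linZ c x : f (c *: x) = c *: f x.
Proof. by have := lf c x 0; rewrite lin0 !addr0. Qed.

Lemma linN x : f (- x) = - f x.
Proof. by rewrite -scaleN1r linZ scaleN1r. Qed.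

Lemma linB x y : f (x - y) = f x - f y.
Proof. by rewrite linD linN. Qed.

Lemma lin_sum (I : Type) (s : seq I) (P : pred I) (F : I -> V) :
  f (\sum_(i <- s | P i) F i) = \sum_(i <- s | P i) f (F i).
Proof.
elim: s => [|i s IH]; first by rewrite !big_nil lin0.
by rewrite !big_cons; case: (P i) => //; rewrite linD IH.
Qed.

Lemma lin_inj : (forall x, f x = 0 -> x = 0) -> injective f.
Proof.
by move=> f0 x y fxy; apply/eqP; rewrite -subr_eq0; apply/eqP/f0;
  rewrite linB fxy subrr.
Qed.

End LinearMaps.

Section Independence.
Variables (K : fieldType) (V : lmodType K).
Implicit Types (x : nat -> V) (v : V) (n : nat).

Definition comb n x (c : nat -> K) : V := \sum_(k < n) c k *: x k.

Definition independent n x : Prop :=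
  forall c, comb n x c = 0 -> forall k, (k < n)%N -> c k = 0.

Definition scons v x : nat -> V := fun k => if k is k'.+1 then x k' else v.

Lemma comb_scons n v x c :
  comb n.+1 (scons v x) c = c 0%N *: v + comb n x (fun k => c k.+1).
Proof. by rewrite /comb big_ord_recl. Qed.

Lemma comb_scale n x a c : a *: comb n x c = comb n x (fun k => a * c k).
Proof. by rewrite scaler_sumr; apply: eq_bigr => k _; rewrite scalerA. Qed.

Lemma independent_scons n v x :
  independent n x -> (forall c, v <> comb n x c) -> independent n.+1 (scons v x).
Proof.
move=> ind_x vNx c; rewrite comb_scons => /eqP; rewrite addr_eq0 => /eqP cv.
have c0 : c 0%N = 0.
  apply/eqP/negPn/negP => c0; apply: (vNx (fun k => - (c 0%N)^-1 * c k.+1)).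
  by rewrite -comb_scale scaleNr -scalerN -cv scalerK.
move/eqP: cv; rewrite c0 scale0r eq_sym oppr_eq0 => /eqP/ind_x cS.
by case=> [//|k]; exact: cS.
Qed.

(** More vectors than generators: the matrix of their coordinates has fewer
    columns than rows, hence a nonzero left kernel. *)
Lemma independent_leq (P : set V) (t : seq V) n x :
  (forall v, P v -> exists c : nat -> K, v = \sum_(k < size t) c k *: t`_k) ->
  (forall k, (k < n)%N -> P (x k)) -> independent n x -> (n <= size t)%N.
Proof.
move=> tP xP ind_x; rewrite leqNgt; apply/negP => lt_tn.
case: n => // n in xP ind_x lt_tn *.
have /choice[c cE] : forall k : 'I_n.+1, exists c : nat -> K,
    x k = \sum_(l < size t) c l *: t`_l by move=> k; apply/tP/xP.
pose M := \matrix_(k < n.+1, l < size t) c k l.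
have [u uM u0] : exists2 u : 'rV_n.+1, u *m M = 0 & u != 0.
  have : kermx M != 0.
    rewrite -mxrank_eq0 mxrank_ker subn_eq0 -ltnNge.
    exact: leq_ltn_trans (rank_leq_col _) lt_tn.
  by case/rowV0Pn=> u /sub_kermxP ? ?; exists u.
case/eqP: u0; apply/rowP => k; rewrite mxE.
rewrite -[k]inord_val; apply: (ind_x (fun k => u 0 (inord k))) => //.
rewrite /comb; under eq_bigr => i _ do rewrite inord_val cE scaler_sumr.
rewrite exchange_big big1 //= => l _.
under eq_bigr => i _ do rewrite scalerA.
have uMl : \sum_(i < n.+1) u 0 i * c i l = (u *m M) 0 l.
  by rewrite mxE; apply: eq_bigr => i _; rewrite mxE.
by rewrite -scaler_suml uMl uM mxE scale0r.
Qed.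

Lemma basis_exists : fin_spanned [set: V] ->
  exists n x, independent n x /\ forall v, exists c, v = comb n x c.
Proof.
case=> t tV; pose has_ind n := `[< exists x, independent n x >].
have has0 : exists n, has_ind n by exists 0%N; apply/asboolP; exists (fun=> 0).
have bound n : has_ind n -> (n <= size t)%N.
  move=> /asboolP[x ind_x]; exact: (@independent_leq setT t n x tV).
case: (ex_maxnP has0 bound) => n /asboolP[x ind_x] n_max.
exists n, x; split=> // v; apply: contrapT => vNx.
suff /n_max : has_ind n.+1 by rewrite ltnn.
apply/asboolP; exists (scons v x); apply: independent_scons => // c vE.
by apply: vNx; exists c.
Qed.

End Independence.

(** Zorn's lemma, applied to the sets closed under the operations that meet
    [S] trivially; these may be empty, so the vector 0 is adjoined to a
    maximal one. *)
Lemma complement_exists (K : fieldType) (V : lmodType K) (S : set V) :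
  subspace S -> exists C : set V,
    [/\ subspace C, forall x, S x -> C x -> x = 0
      & forall v, exists s c, [/\ S s, C c & v = s + c]].
Proof.
move=> [S0 SD SZ].
pose P (C : set V) := [/\ forall x y, C x -> C y -> C (x + y),
  forall (a : K) x, C x -> C (a *: x) & forall x, S x -> C x -> x = 0].
have [F FP totF|C [[CD CZ SC] C_max]] := @Zorn_bigcup V P.
  split=> [x y [X FX Xx] [Y FY Yy]|a x [X FX Xx]|x Sx [X FX Xx]].
  - have [XY|YX] := totF _ _ FX FY.
      by exists Y => //; have [+ _ _] := FP _ FY; apply=> //; exact: XY.
    by exists X => //; have [+ _ _] := FP _ FX; apply=> //; exact: YX.
  - by exists X => //; have [_ + _] := FP _ FX; apply.
  - by have [_ _ +] := FP _ FX; apply.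
pose C1 : set V := fun x => C x \/ x = 0.
have C1D x y : C1 x -> C1 y -> C1 (x + y).
  move=> [Cx|->] [Cy|->]; rewrite ?addr0 ?add0r; try by [left|right].
  by left; exact: CD.
have C1Z (a : K) x : C1 x -> C1 (a *: x).
  by move=> [Cx|->]; [left; exact: CZ | right; rewrite scaler0].
have SC1 x : S x -> C1 x -> x = 0 by move=> Sx [Cx|//]; exact: SC.
exists C1; split=> //; first by split=> //; right.
move=> v; apply: contrapT => vN.
pose B : set V := fun x => exists (a : K) c, C1 c /\ x = a *: v + c.
have BP : P B.
  split=> [x y [a [c [Cc ->]]] [b [d [Cd ->]]]|b x [a [c [Cc ->]]]|].
  - by exists (a + b), (c + d); split; [exact: C1D | rewrite scalerDl addrACA].
  - by exists (b * a), (b *: c); split; [exact: C1Z | rewrite scalerDr scalerA].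
  move=> x Sx [a [c [Cc xE]]]; have [a0|a0] := eqVneq a 0.
    by apply: SC1 => //; rewrite xE a0 scale0r add0r.
  case: vN; exists (a^-1 *: x), (- (a^-1 *: c)); split; first exact: SZ.
    by rewrite -scaleN1r; apply/C1Z/C1Z.
  by rewrite xE scalerDr scalerK // addrK.
apply: (C_max B _ BP); split=> [x Cx|BC].
  by exists 0, x; rewrite scale0r add0r; split=> //; left.
apply: vN; exists 0, v; split; rewrite ?add0r //; left; apply: BC.
by exists 1, 0; split; [right | rewrite scale1r addr0].
Qed.

(** Choose a complement [C] of the image of [u] and let the extension vanish
    on it. *)
Lemma extend_linear (K : fieldType) (M N W : lmodType K) (u : M -> N)
    (f : M -> W) : linear u -> injective u -> linear f ->
  exists2 g : N -> W, linear g & forall m, g (u m) = f m.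
Proof.
move=> lu u_inj lf.
have [|C [[C0 CD CZ] SC VSC]] :=
    @complement_exists K N (fun x => exists m, x = u m).
  split; first by exists 0; rewrite lin0.
    by move=> _ _ [m ->] [n ->]; exists (m + n); rewrite linD.
  by move=> c _ [m ->]; exists (c *: m); rewrite linZ.
have /choice[p pC] : forall x, exists m, C (x - u m).
  by move=> x; have [_ [c [[m ->] Cc ->]]] := VSC x; exists m; rewrite addrC addKr.
have p_uniq x m : C (x - u m) -> p x = m.
  move=> Cm; apply/u_inj/eqP; rewrite -subr_eq0; apply/eqP/SC.
    by exists (p x - m); rewrite linB.
  rewrite (_ : _ - _ = (x - u m) + (-1) *: (x - u (p x))).
    by apply: CD => //; apply/CZ/pC.
  by rewrite scaleN1r opprB [RHS]addrC addrA subrK.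
exists (f \o p) => [c x y|m] /=; last first.
  by rewrite (p_uniq _ m) // subrr.
rewrite -lf; congr f; apply: p_uniq; rewrite lu.
rewrite opprD addrACA -scalerBr; apply: CD; [apply: CZ; exact: pC | exact: pC].
Qed.

Lemma functional_exists (K : fieldType) (V : lmodType K) (w : V) :
  w != 0 -> exists2 f : V -> K, linear_for *%R f & f w = 1.
Proof.
move=> w0.
have [||//|f lf fw] := @extend_linear K K^o V K^o (fun c => c *: w) id.
- by move=> c x y /=; rewrite scalerDl scalerA.
- by apply: lin_inj => [c x y|c /eqP]; rewrite ?scalerDl ?scalerA //
    scaler_eq0 (negPf w0) orbF => /eqP.
by exists f => //; rewrite -[w]scale1r fw.
Qed.

(** * Algebras with enough idempotents *)

Section EnoughIdempotents.
Variables (K : fieldType) (A : ealgebra K).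
Implicit Types (a b c x : A) (i j k : eidx A).

Lemma emul0l a : 0 ** a = 0. Proof. exact: lin0 (emul_linl a). Qed.
Lemma emul0r a : a ** 0 = 0. Proof. exact: lin0 (emul_linr a). Qed.
Lemma emulDl a b c : (a + b) ** c = a ** c + b ** c.
Proof. exact: linD (emul_linl c) _ _. Qed.
Lemma emulDr a b c : a ** (b + c) = a ** b + a ** c.
Proof. exact: linD (emul_linr a) _ _. Qed.
Lemma emulBl a b c : (a - b) ** c = a ** c - b ** c.
Proof. exact: linB (emul_linl c) _ _. Qed.
Lemma emulBr a b c : a ** (b - c) = a ** b - a ** c.
Proof. exact: linB (emul_linr a) _ _. Qed.
Lemma emulZl (t : K) a b : (t *: a) ** b = t *: (a ** b).
Proof. exact: linZ (emul_linl b) _ _. Qed.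
Lemma emulZr (t : K) a b : a ** (t *: b) = t *: (a ** b).
Proof. exact: linZ (emul_linr a) _ _. Qed.
Lemma emul_suml (I : Type) (s : seq I) (F : I -> A) a :
  (\sum_(i <- s) F i) ** a = \sum_(i <- s) F i ** a.
Proof. exact: (lin_sum (emul_linl a) s xpredT F). Qed.
Lemma emul_sumr (I : Type) (s : seq I) (F : I -> A) a :
  a ** (\sum_(i <- s) F i) = \sum_(i <- s) a ** F i.
Proof. exact: (lin_sum (emul_linr a) s xpredT F). Qed.

Lemma emul_congr a a' b b' : a = a' -> b = b' -> a ** b = a' ** b'.
Proof. by move=> -> ->. Qed.

Lemma eid_idem i : eid i ** eid i = eid i :> A.
Proof. by rewrite eid_orth eqxx. Qed.

Lemma left_corner_eid i : left_corner i (eid i : A).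
Proof. exact: eid_idem. Qed.

Lemma left_corner_mul i a : left_corner i (eid i ** a).
Proof. by rewrite /left_corner /= emulA eid_idem. Qed.

Lemma right_corner_mul j a : right_corner j (a ** eid j).
Proof. by rewrite /right_corner /= -emulA eid_idem. Qed.

Lemma left_cornerM i a b : left_corner i a -> left_corner i (a ** b).
Proof. by rewrite /left_corner /= emulA => ->. Qed.

Lemma left_corner_orth i j a : left_corner i a -> j != i -> eid j ** a = 0.
Proof. by move=> <- ji; rewrite emulA eid_orth (negPf ji) emul0l. Qed.

Lemma corner_mul i j a : corner i j (eid i ** a ** eid j).
Proof.
by split; [exact/left_cornerM/left_corner_mul | exact: right_corner_mul].
Qed.

Lemma corner_product i k j a b :
  (eid i ** a ** eid k) ** (eid k ** b ** eid j) =
  eid i ** (a ** eid k ** b) ** eid j.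
Proof. by rewrite !emulA -(emulA (eid i ** a) (eid k) (eid k)) eid_idem. Qed.

Lemma right_component_neq0 a : a != 0 -> exists j, a ** eid j != 0.
Proof.
move=> a0; apply: contrapT => aN; case/eqP: a0.
have [s _ ->] := eid_sumr a; apply: big1_seq => i _.
by apply: contrapT => /eqP ?; apply: aN; exists i.
Qed.

Lemma left_component_neq0 a : a != 0 -> exists j, eid j ** a != 0.
Proof.
move=> a0; apply: contrapT => aN; case/eqP: a0.
have [s _ ->] := eid_suml a; apply: big1_seq => i _.
by apply: contrapT => /eqP ?; apply: aN; exists i.
Qed.

Lemma linear_left_ext (W : lmodType K) (f g : A -> W) :
  linear f -> linear g -> (forall i a, left_corner i a -> f a = g a) -> f =1 g.
Proof.
move=> lf lg fg a; have [s _ ->] := eid_suml a.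
rewrite !lin_sum //; apply: eq_bigr => i _; apply: fg; exact: left_corner_mul.
Qed.

(** Since [A] is the direct sum of the [e_i A], maps given on the summands
    glue; each element involves finitely many summands only. *)
Lemma glue_left (W : lmodType K) (T : eidx A -> A -> W) :
  (forall i, linear (T i)) ->
  exists2 D : A -> W, linear D & forall i a, left_corner i a -> D a = T i a.
Proof.
move=> lT.
have /choice[s sP] : forall a, exists s : seq (eidx A),
    uniq s /\ a = \sum_(i <- s) eid i ** a.
  by move=> a; have [s ? ?] := eid_suml a; exists s.
pose D a := \sum_(i <- s a) T i (eid i ** a).
have DE a (t : seq (eidx A)) : uniq t -> {subset s a <= t} ->
    D a = \sum_(i <- t) T i (eid i ** a).
  move=> ut st; have [us aE] := sP a.
  rewrite (bigID (mem (s a))) /= [X in _ + X]big1_seq ?addr0 => [|i /andP[iNs _]].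
    rewrite -[RHS]big_filter; apply: perm_big; apply: uniq_perm => //.
      exact: filter_uniq.
    by move=> i; rewrite mem_filter; case is_ : (i \in s a) => //=; rewrite st.
  rewrite aE emul_sumr big1_seq ?lin0 // => j /andP[_ js].
  rewrite emulA eid_orth; case: eqP => [ij|_]; last by rewrite emul0l.
  by rewrite ij /= js in iNs.
exists D => [c x y|i a ai].
  pose t := undup (s (c *: x + y) ++ s x ++ s y).
  have ut : uniq t := undup_uniq _.
  rewrite !(DE _ t) //;
    try by move=> i; rewrite mem_undup !mem_cat => ->; rewrite ?orbT.
  rewrite scaler_sumr -big_split; apply: eq_bigr => i _ /=.
  by rewrite emul_linr lT.
rewrite (DE _ (undup (i :: s a))) ?undup_uniq //; last first.
  by move=> k; rewrite mem_undup inE => ->; rewrite orbT.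
rewrite (bigD1_seq i) ?undup_uniq ?mem_undup ?mem_head //= ai.
rewrite big1 ?addr0 // => k ki.
rewrite (left_corner_orth ai ki) lin0 //; exact: lT.
Qed.

End EnoughIdempotents.

(** * Augmentations and locality *)

Section Augmentation.
Variables (K : fieldType) (A : ealgebra K).
Implicit Types (a b c x m : A) (i j k : eidx A).

(** One character of [A] for each idempotent; in a path algebra modulo
    relations these are the coefficients of the trivial paths. *)
Definition augmentation (eps : eidx A -> A -> K) : Prop :=
  [/\ forall i, linear_for *%R (eps i),
      forall i a b, eps i (a ** b) = eps i a * eps i b
    & forall i j, eps i (eid j) = (i == j)%:R].

(** [e_i A e_i] is local with residue field [K], and its maximal ideal is the
    kernel of [eps i]. *)
Definition augmented_local (eps : eidx A -> A -> K) : Prop :=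
  forall i x, corner i i x -> eps i x != 0 -> corner_unit i x.

Variable eps : eidx A -> A -> K.
Hypothesis aug : augmentation eps.

Lemma eps_lin i : linear (eps i : A -> K^o).
Proof. by have [h _ _] := aug; exact: h. Qed.
Lemma epsM i a b : eps i (a ** b) = eps i a * eps i b.
Proof. by have [_ h _] := aug; exact: h. Qed.
Lemma eps_eid i j : eps i (eid j) = (i == j)%:R.
Proof. by have [_ _ h] := aug; exact: h. Qed.
Lemma eps_eid1 i : eps i (eid i) = 1. Proof. by rewrite eps_eid eqxx. Qed.
Lemma eps0 i : eps i 0 = 0. Proof. exact: lin0 (eps_lin i). Qed.
Lemma epsB i a b : eps i (a - b) = eps i a - eps i b.
Proof. exact: linB (eps_lin i) _ _. Qed.
Lemma epsZ i (t : K) a : eps i (t *: a) = t * eps i a.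
Proof. exact: linZ (eps_lin i) _ _. Qed.

Lemma eps_unit i x : corner_unit i x -> eps i x != 0.
Proof.
move=> [y _ [xy _]]; apply: contraTneq isT => x0.
by have := eps_eid1 i; rewrite -xy epsM x0 mul0r => /esym/eqP; rewrite oner_eq0.
Qed.

(** Scale [x] so that [eps i x = 1]. Then [x] and [e_i - x] add up to a unit,
    while [e_i - x], being killed by [eps i], is not one. *)
Lemma local_corners_augmented_local :
  (forall i, local_corner (A := A) i) -> augmented_local eps.
Proof.
move=> loc i x [xl xr] x0; apply: contrapT => xNu.
pose y := (eps i x)^-1 *: x.
have yc : corner i i y.
  by split; rewrite /left_corner /right_corner /= ?emulZl ?emulZr ?xl ?xr.
have ec : corner i i (eid i : A) by split; exact: eid_idem.
have zc : corner i i (eid i - y).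
  by case: ec yc => e1 e2 [y1 y2]; split; rewrite /left_corner /right_corner /=
    ?emulBl ?emulBr ?e1 ?e2 ?y1 ?y2.
apply: (loc i y (eid i - y) yc zc).
- move=> [z [zl zr] [yz zy]]; apply: xNu; exists ((eps i x)^-1 *: z).
    by split; rewrite /left_corner /right_corner /= ?emulZl ?emulZr ?zl ?zr.
  by rewrite emulZr -emulZl yz emulZl -emulZr zy.
- by move/eps_unit; rewrite epsB eps_eid1 epsZ mulVf // subrr eqxx.
by rewrite addrC subrK; exists (eid i) => //; rewrite eid_idem.
Qed.

Hypothesis loc : augmented_local eps.

Let unit_sub i x : eps i x = 0 ->
  corner i i (eid i - eid i ** x ** eid i) /\
  corner_unit i (eid i - eid i ** x ** eid i).
Proof.
move=> x0; have [l r] := corner_mul i i x.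
have c : corner i i (eid i - eid i ** x ** eid i).
  by split; rewrite /left_corner /right_corner /= ?emulBl ?emulBr ?eid_idem ?l ?r.
split=> //; apply: loc => //.
by rewrite epsB !epsM eps_eid1 x0 mulr0 mul0r subr0 oner_eq0.
Qed.

(** [e_j - e_j x e_j] is invertible in the local corner [e_j A e_j] and
    annihilates [m]. *)
Lemma fixed_right_eq0 j m x :
  m ** eid j = m -> eps j x = 0 -> m ** x = m -> m = 0.
Proof.
move=> mj x0 mx; have [_ [y _ [uy _]]] := unit_sub x0.
rewrite -mj -uy emulA emulBr !emulA mj mx mj subrr.
exact: emul0l.
Qed.

Lemma fixed_left_eq0 i m x :
  eid i ** m = m -> eps i x = 0 -> x ** m = m -> m = 0.
Proof.
move=> mi x0 xm; have [_ [y _ [_ yu]]] := unit_sub x0.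
rewrite -mi -yu -emulA emulBl -!emulA mi xm mi subrr.
exact: emul0r.
Qed.

(** The algebra is then weakly basic: for [a] in [e_i A e_j] with [i <> j],
    every [e_i - e_i a b e_i] is invertible in [e_i A e_i], so that [a] lies in
    every maximal right ideal. *)
Lemma augmented_local_weakly_basic : weakly_basic A.
Proof.
split=> [i a b ca cb aNu bNu /eps_unit|i j ij a [al ar] I [Iid IT I_max]].
  have eps0 x : corner i i x -> ~ corner_unit i x -> eps i x = 0.
    by move=> cx xNu; apply/eqP/negPn/negP => /(loc cx).
  have [+ _ _] := aug; move=> /(_ i 1 a b); rewrite scale1r mul1r => ->.
  by rewrite !eps0 // addr0 eqxx.
have [[I0 ID IZ] IM] := Iid; apply: contrapT => aNI.
pose J : set A := fun x => exists y b, I y /\ x = y + a ** b.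
have IJ : (I `<=` J)%classic by move=> x Ix; exists x, 0; rewrite emul0r addr0.
have Jid : right_ideal J.
  split; first split.
  - exact: IJ.
  - move=> _ _ [y [b [Iy ->]]] [z [c [Iz ->]]]; exists (y + z), (b + c).
    by rewrite emulDr addrACA; split=> //; apply: ID.
  - move=> t _ [y [b [Iy ->]]]; exists (t *: y), (t *: b).
    by rewrite emulZr scalerDr; split=> //; apply: IZ.
  move=> _ c [y [b [Iy ->]]]; exists (y ** c), (b ** c).
  by rewrite emulDl emulA; split=> //; apply: IM.
have [JI|JT] := I_max _ Jid IJ.
  apply: aNI; rewrite -JI; exists 0, (eid j); rewrite add0r; split=> //.
have [y [b [Iy eE]]] : J (eid i) by rewrite JT.
have ab0 : eps i (a ** b) = 0.
  by rewrite epsM -ar epsM eps_eid; case: eqP ij => // _ _; rewrite mulr0 mul0r.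
have [_ [z [zl _] [uz _]]] := unit_sub ab0.
apply: aNI; rewrite -al; apply: (IM); rewrite -uz; apply: (IM).
have -> : eid i - eid i ** (a ** b) ** eid i = y ** eid i.
  have -> : y = eid i - a ** b by rewrite eE addrK.
  by rewrite emulBl eid_idem emulA al.
exact: IM.
Qed.

End Augmentation.

(** * Socles *)

(** [n] spans a simple right submodule of [e_i A], on which [A] acts through
    the character [eps j]. *)
Definition socle_vector (K : fieldType) (A : ealgebra K)
    (eps : eidx A -> A -> K) (i j : eidx A) (n : A) : Prop :=
  [/\ n != 0, eid i ** n = n & forall x, n ** x = eps j x *: n].

Section SocleExistence.
Variables (K : fieldType) (A : ealgebra K) (eps : eidx A -> A -> K).
Hypotheses (aug : augmentation eps) (loc : augmented_local eps).
Implicit Types (a b m n x : A) (i j k : eidx A).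

Lemma socle_vector_right i j n : socle_vector eps i j n -> n ** eid j = n.
Proof. by move=> [_ _ ->]; rewrite (eps_eid1 aug) scale1r. Qed.

(** If [m A] contains no socle vector, then [m], [m r1], [m r1 r2], ... can be
    continued forever with all [r] killed by the augmentation. Such vectors are
    independent: in a relation, the first vector with a nonzero coefficient
    would be fixed by right multiplication with an element killed by the
    augmentation. *)
Lemma long_independent_chain i (k : nat) m j :
    m != 0 -> left_corner i m -> m ** eid j = m ->
    (forall l b, ~ socle_vector eps i l (m ** b)) ->
  exists2 x : nat -> A,
    forall l, (l < k)%N -> exists2 r, eps j r = 0 & x l = m ** r
    & independent k.+1 (scons m x).
Proof.
elim: k m j => [|k IH] m j m0 im mj noS.
  exists (fun=> 0) => //; apply: independent_scons => // c.
  by rewrite /comb big_ord0; exact/eqP.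
have [x mx] : exists x, m ** x <> eps j x *: m.
  apply: contrapT => mN; apply: (noS j (eid j)); rewrite mj; split=> // x.
  by apply: contrapT => mx; apply: mN; exists x.
pose r0 := x - eps j x *: eid j.
have mr0 : m ** r0 != 0.
  by rewrite emulBr emulZr mj subr_eq0; exact/eqP.
have [l mrl] := right_component_neq0 mr0; rewrite -emulA in mrl.
pose r := r0 ** eid l.
have r_eps : eps j r = 0.
  by rewrite (epsM aug) (epsB aug) (epsZ aug) (eps_eid1 aug) mulr1 subrr mul0r.
have [||y yR y_ind] := IH (m ** r) l mrl (left_cornerM _ im).
- by rewrite -!emulA eid_idem.
- by move=> l' b; rewrite -emulA; exact: noS.
have xR l' : (l' < k.+1)%N ->
    exists2 s, eps j s = 0 & scons (m ** r) y l' = m ** s.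
  case: l' => [_|l' lk]; first by exists r.
  have [s s0 /= ->] := yR l' lk; exists (r ** s); last by rewrite emulA.
  by rewrite (epsM aug) r_eps mul0r.
exists (scons (m ** r) y) => //; apply: independent_scons => // c mE.
have [s s0 msE] : exists2 s, eps j s = 0 & comb k.+1 (scons (m ** r) y) c = m ** s.
  apply: (big_ind (fun v => exists2 s, eps j s = 0 & v = m ** s)).
  - by exists 0; rewrite ?(eps0 aug) ?emul0r.
  - move=> _ _ [s s0 ->] [t t0 ->]; exists (s + t); last by rewrite emulDr.
    by rewrite (linD (eps_lin aug j)) s0 t0 addr0.
  move=> l' _; have [s s0 ->] := xR l' (ltn_ord l').
  by exists (c l' *: s); rewrite ?(epsZ aug) ?s0 ?mulr0 ?emulZr.
rewrite msE in mE; case/eqP: m0.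
exact: (fixed_right_eq0 aug loc mj s0 (esym mE)).
Qed.

(** Chains as above are no longer than a generating list of [e_i A]. *)
Lemma socle_vector_exists i a : fin_spanned (left_corner (A := A) i) ->
  left_corner i a -> a != 0 -> exists j b, socle_vector eps i j (a ** b).
Proof.
move=> [t tP] ia a0; apply: contrapT => aN.
have [j aj0] := right_component_neq0 a0.
have [|||x xR] := @long_independent_chain i (size t) (a ** eid j) j aj0.
- exact: left_cornerM.
- by rewrite -emulA eid_idem.
- by move=> l b; rewrite -emulA => S; apply: aN; exists l, (eid j ** b).
move/(independent_leq tP) => h; suff : (size t < size t)%N by rewrite ltnn.
apply: h => -[_|k /xR[r _ /= ->]]; first exact: left_cornerM.
exact/left_cornerM/left_cornerM.
Qed.

End SocleExistence.

Lemma fin_dim_corner (K : fieldType) (A : ealgebra K) (i : eidx A) :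
  fin_dim A -> fin_spanned (left_corner (A := A) i).
Proof. by move=> [t tP]; exists t => x _; exact: tP. Qed.

(** An idempotent occurring in none of the finitely many generators is
    annihilated by all of them. *)
Lemma fin_dim_indices (K : fieldType) (A : ealgebra K) : fin_dim A ->
  exists2 L : seq (eidx A), uniq L & forall i, i \in L.
Proof.
move=> [t tP].
have /choice[s sP] : forall a : A, exists s : seq (eidx A),
    a = \sum_(i <- s) a ** eid i.
  by move=> a; have [s _ ?] := eid_sumr a; exists s.
exists (undup (flatten (map s t))) => [|i]; first exact: undup_uniq.
rewrite mem_undup; apply: contraT => iN; have [c iE] := tP (eid i) I.
case/negP: (eid_neq0 i); rewrite -eid_idem {1}iE emul_suml big1 // => k _.
rewrite emulZl (sP t`_k) emul_suml big1_seq ?scaler0 // => l /andP[_ lk].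
rewrite -emulA eid_orth; case: eqP => [li|_]; last by rewrite emul0r.
case/negP: iN; apply/flattenP; exists (s t`_k); last by rewrite -li.
exact/map_f/mem_nth.
Qed.

Lemma unit_sum (K : fieldType) (A : ealgebra K) (L : seq (eidx A)) (a : A) :
  uniq L -> (forall i, i \in L) -> a ** (\sum_(i <- L) eid i) = a.
Proof.
move=> uL LP; rewrite emul_sumr; have [s us aE] := eid_sumr a.
rewrite [RHS]aE (bigID (mem s)) /= [X in _ + X]big1_seq ?addr0 => [|i /andP[iNs _]].
  rewrite -big_filter; apply: perm_big; apply: uniq_perm => //.
    exact: filter_uniq.
  by move=> i; rewrite mem_filter LP andbT.
rewrite aE emul_suml big1_seq // => j /andP[_ js].
rewrite -emulA eid_orth; case: eqP => [ij|_]; last by rewrite emul0r.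
by rewrite -ij /= js in iNs.
Qed.

(** * Self-injectivity *)

Section CyclicModule.
Variables (K : fieldType) (A : ealgebra K) (b : A).
Implicit Types (a x : A).

Lemma annihilator_subspace : subspace (fun x => b ** x = 0).
Proof.
split=> [|x y bx by_|c x bx]; first exact: emul0r.
  by rewrite emulDr bx by_ addr0.
by rewrite emulZr bx scaler0.
Qed.

Definition annihilator : submod A := Submod annihilator_subspace.

Definition cyclic_act (q : qspace annihilator) a : qspace annihilator :=
  qproj annihilator (qrepr q ** a).

Lemma annihilator_repr x :
  b ** qrepr (qproj annihilator x) = b ** x.
Proof.
apply/eqP; rewrite -subr_eq0 -emulBr; apply/eqP.
by apply/(qprojP annihilator); rewrite qreprK.
Qed.

Lemma cyclic_act_proj x a :
  cyclic_act (qproj annihilator x) a = qproj annihilator (x ** a).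
Proof.
apply/qprojP; rewrite /= emulBr !emulA annihilator_repr.
exact: subrr.
Qed.

Lemma cyclic_act_linl a : linear (cyclic_act^~ a).
Proof.
move=> c p q /=; rewrite -[p]qreprK -[q]qreprK !cyclic_act_proj.
rewrite -(linearP (qproj annihilator)) -(linearP (qproj annihilator)) /=.
by rewrite cyclic_act_proj emul_linl.
Qed.

Lemma cyclic_act_linr q : linear (cyclic_act q).
Proof.
move=> c x y; rewrite -[q]qreprK !cyclic_act_proj.
by rewrite -!(linearP (qproj annihilator)) emul_linr.
Qed.

Lemma cyclic_actA q x y : cyclic_act (cyclic_act q x) y = cyclic_act q (x ** y).
Proof. by rewrite -[q]qreprK !cyclic_act_proj emulA. Qed.

Lemma cyclic_unital q :
  exists2 s : seq (eidx A), uniq s & q = \sum_(i <- s) cyclic_act q (eid i).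
Proof.
have [s us xE] := eid_sumr (qrepr q); exists s => //.
by rewrite -[LHS]qreprK {1}xE linear_sum.
Qed.

(** The right module [b A], presented as [A] modulo the annihilator. *)
Definition cyclic_module : rmodule A :=
  RModule cyclic_act_linl cyclic_act_linr cyclic_actA cyclic_unital.

Lemma cyclic_embedding_hom :
  @rhom K A cyclic_module (regular_module A) (fun q => b ** qrepr q).
Proof.
split=> [c p q|q a] /=.
  rewrite -[p]qreprK -[q]qreprK -(linearP (qproj annihilator)) /=.
  by rewrite !annihilator_repr emul_linr.
by rewrite -[q]qreprK cyclic_act_proj !annihilator_repr emulA.
Qed.

Lemma cyclic_embedding_inj : injective (fun q : cyclic_module => b ** qrepr q).
Proof.
move=> p q /= /eqP; rewrite -subr_eq0 -emulBr => /eqP pq.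
by rewrite -[p]qreprK -[q]qreprK; apply/qprojP.
Qed.

Lemma cyclic_hom w : (forall x, b ** x = 0 -> w ** x = 0) ->
  @rhom K A cyclic_module (regular_module A) (fun q => w ** qrepr q).
Proof.
move=> bw.
have wE x : w ** qrepr (qproj annihilator x) = w ** x.
  apply/eqP; rewrite -subr_eq0 -emulBr; apply/eqP/bw.
  by rewrite emulBr annihilator_repr subrr.
split=> [c p q|q a] /=.
  rewrite -[p]qreprK -[q]qreprK -(linearP (qproj annihilator)) /=.
  by rewrite !wE emul_linr.
by rewrite -[q]qreprK cyclic_act_proj !wE emulA.
Qed.

(** The homomorphism [b x |-> w x] extends to the regular module, where
    homomorphisms are left multiplications. *)
Lemma self_injective_left_multiple j w e : self_injective A ->
    eid j ** b = b -> b ** e = b -> w ** e = w ->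
    (forall x, b ** x = 0 -> w ** x = 0) ->
  exists x, x ** b = w.
Proof.
move=> si jb be we bw.
have [g [_ gM] gE] :=
  si _ _ _ _ cyclic_embedding_hom cyclic_embedding_inj (cyclic_hom bw).
have gMb : g (eid j ** b) = g (eid j) ** b := gM (eid j) b.
have := gE (qproj annihilator e); rewrite annihilator_repr be => gb.
exists (g (eid j)); rewrite -gMb jb gb.
apply/eqP; rewrite -[X in _ == X]we -subr_eq0 -emulBr; apply/eqP/bw.
by rewrite emulBr annihilator_repr subrr.
Qed.

End CyclicModule.

Section SelfInjectiveSocle.
Variables (K : fieldType) (A : ealgebra K) (eps : eidx A -> A -> K).
Hypotheses (aug : augmentation eps) (loc : augmented_local eps).
Hypothesis (si : self_injective A).
Implicit Types (a b m n w x : A) (i j k u v : eidx A).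

(** The two vectors span isomorphic simple modules. *)
Lemma socle_vectors_connected u v j m n :
  socle_vector eps v j m -> socle_vector eps u j n -> exists x, x ** m = n.
Proof.
move=> mS nS; have [m0 vm mE] := mS; have [_ _ nE] := nS.
apply: (self_injective_left_multiple si vm (socle_vector_right aug mS)
  (socle_vector_right aug nS)) => x.
rewrite mE nE => /eqP; rewrite scaler_eq0 (negPf m0) orbF => /eqP ->.
exact: scale0r.
Qed.

(** Going from [m] to [n] and back is multiplication by an element that
    factors through [e_u], hence is killed by [eps v]. *)
Lemma socle_vector_source u v j m n :
  socle_vector eps v j m -> socle_vector eps u j n -> u = v.
Proof.
move=> mS nS; have [m0 vm _] := mS; have [_ un _] := nS.
have [x xm] := socle_vectors_connected mS nS.
have [y yn] := socle_vectors_connected nS mS.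
apply/eqP/negPn/negP => uv; case/eqP: m0.
apply: (fixed_left_eq0 aug loc vm (x := y ** eid u ** x)).
  by rewrite !(epsM aug) (eps_eid aug) eq_sym (negPf uv) mulr0 mul0r.
by rewrite -!emulA xm un.
Qed.

(** With [socle_vector_line]: the socle of the indecomposable injective module
    [e_v A] is simple. If the characters of [m] and [n] differ, then [m] is
    annihilated by whatever annihilates [m + n], so that some element of [A]
    fixes [m] and kills [n]; its component in the local corner [e_v A e_v]
    cannot do both. *)
Lemma socle_vector_target v j k m n :
  socle_vector eps v j m -> socle_vector eps v k n -> j = k.
Proof.
move=> mS nS; have [m0 vm mE] := mS; have [n0 vn nE] := nS.
apply/eqP/negPn/negP => jk.
have mj := socle_vector_right aug mS; have nk := socle_vector_right aug nS.
have nj : n ** eid j = 0 by rewrite nE (eps_eid aug) eq_sym (negPf jk) scale0r.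
have mk : m ** eid k = 0 by rewrite mE (eps_eid aug) (negPf jk) scale0r.
have [||||y yE] := @self_injective_left_multiple K A (m + n) v m (eid j + eid k) si.
- by rewrite emulDr vm vn.
- by rewrite emulDr !emulDl mj nj mk nk addr0 add0r.
- by rewrite emulDr mj mk addr0.
- move=> x /(congr1 (fun z => z ** eid j)); rewrite emul0l emulDl emulDl mE nE.
  by rewrite !emulZl mj nj scaler0 addr0.
have ym : y ** m = m.
  by have /(congr1 (fun z => z ** eid j)) := yE; rewrite -emulA emulDl mj nj addr0.
have yn : y ** n = 0.
  by have /(congr1 (fun z => z ** eid k)) := yE; rewrite -emulA emulDl mk nk add0r.
have [y0|y0] := eqVneq (eps v y) 0.
  by case/eqP: m0; exact: (fixed_left_eq0 aug loc vm y0 ym).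
case/eqP: n0; apply: (fixed_left_eq0 aug loc vn (x := eid v - (eps v y)^-1 *: y)).
  by rewrite (epsB aug) (eps_eid1 aug) (epsZ aug) mulVf // subrr.
by rewrite emulBl vn emulZl yn scaler0 subr0.
Qed.

(** [n] is [y m] for some [y], and [y] acts on [m] by the scalar [eps v y]: the
    difference [y' m] is a socle vector or zero; in the first case it could be
    mapped back to [m], which would then be fixed by an element killed by
    [eps v]. *)
Lemma socle_vector_line v j m n :
  socle_vector eps v j m -> socle_vector eps v j n -> exists c, n = c *: m.
Proof.
move=> mS nS; have [m0 vm mE] := mS; have [n0 vn nE] := nS.
have [y ym] := socle_vectors_connected mS nS.
exists (eps v y); apply/eqP; rewrite -subr_eq0; apply/negPn/negP => p0.
pose y' := y - eps v y *: eid v.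
have y'm : y' ** m = n - eps v y *: m by rewrite emulBl ym emulZl vm.
have [|z zE] :=
    @socle_vectors_connected v v j (n - eps v y *: m) m _ mS.
  split=> // [|x]; first by rewrite emulBr emulZr vm vn.
  by rewrite emulBl emulZl mE nE scalerBr !scalerA mulrC.
case/eqP: m0; apply: (fixed_left_eq0 aug loc vm (x := z ** y')).
  by rewrite (epsM aug) (epsB aug) (epsZ aug) (eps_eid1 aug) mulr1 subrr mulr0.
by rewrite -emulA y'm.
Qed.

(** An [x] with [b x = 0] is killed by [eps k], since [b] would otherwise be
    fixed by [e_k - x / eps k x]; hence [x] annihilates [w] as well. *)
Lemma socle_vector_left_multiple v k w j b :
  socle_vector eps v k w -> corner j k b -> b != 0 -> exists x, x ** b = w.
Proof.
move=> wS [jb bk] b0; have [_ _ wE] := wS.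
apply: (self_injective_left_multiple si jb bk (socle_vector_right aug wS)) => x bx.
rewrite wE; have [->|x0] := eqVneq (eps k x) 0; first exact: scale0r.
case/eqP: b0; apply: (fixed_right_eq0 aug loc bk (x := eid k - (eps k x)^-1 *: x)).
  by rewrite (epsB aug) (eps_eid1 aug) (epsZ aug) mulVf // subrr.
by rewrite emulBr emulZr bx scaler0 subr0.
Qed.

End SelfInjectiveSocle.

(** The Nakayama permutation [nu] of a finite-dimensional self-injective
    algebra, with a generator [w v] of the simple socle of each [e_v A]. *)
Definition nakayama_socle (K : fieldType) (A : ealgebra K)
    (eps : eidx A -> A -> K) (nu : eidx A -> eidx A) (w : eidx A -> A) : Prop :=
  [/\ injective nu /\ (forall k, exists v, nu v = k),
      forall v, socle_vector eps v (nu v) (w v),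
      forall v k n, socle_vector eps v k n -> exists c, n = c *: w v,
      forall v a, left_corner v a -> a != 0 -> exists b, a ** b = w v
    & forall v j b, corner j (nu v) b -> b != 0 -> exists a, a ** b = w v].

(** There are finitely many idempotents, hence the injective map [nu] is onto. *)
Lemma self_injective_nakayama_socle (K : fieldType) (A : ealgebra K)
    (eps : eidx A -> A -> K) :
  augmentation eps -> augmented_local eps -> fin_dim A -> self_injective A ->
  exists nu w, nakayama_socle eps nu w.
Proof.
move=> aug loc fd si.
have /choice[p pS] : forall v, exists p : eidx A * A, socle_vector eps v p.1 p.2.
  move=> v.
  have [j [b S]] := socle_vector_exists aug loc (fin_dim_corner v fd)
    (left_corner_eid v) (eid_neq0 v).
  by exists (j, eid v ** b).
pose nu v := (p v).1; pose w v := (p v).2.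
have nu_inj : injective nu.
  move=> u v uv; apply: (socle_vector_source aug loc si (pS v)).
  by rewrite -/(nu v) -uv; exact: pS.
have line v k n : socle_vector eps v k n -> exists c, n = c *: w v.
  move=> nS; have kE := socle_vector_target aug loc si (pS v) nS.
  by move: nS; rewrite -kE; exact: (socle_vector_line aug loc si (pS v)).
exists nu, w; split=> //.
- split=> // k; have [L uL LP] := fin_dim_indices fd.
  have [|||_ LE] := @uniq_min_size _ (map nu L) L.
  + by rewrite map_inj_uniq.
  + by move=> ? _; exact: LP.
  + by rewrite size_map.
  by have /mapP[v _ ->] : k \in map nu L; [rewrite LE LP | exists v].
- move=> v a va a0.
  have [j [b S]] := socle_vector_exists aug loc (fin_dim_corner v fd) va a0.
  have [c nE] := line _ _ _ S; have [n0 _ _] := S.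
  have c0 : c != 0 by apply: contraNneq n0 => c0; rewrite nE c0 scale0r.
  by exists (c^-1 *: b); rewrite emulZr nE scalerK.
- by move=> v j b; exact: (socle_vector_left_multiple aug loc si (pS v)).
Qed.

(** * Coverings of algebras with enough idempotents *)

Section Coverings.
Variables (K : fieldType) (A' A : ealgebra K).
Variables (eps' : eidx A' -> A' -> K) (eps : eidx A -> A -> K).
Variables (F : eidx A' -> eidx A) (pi : A' -> A).

(** An automorphism of the covering: [g] is its effect on the idempotents. The
    last condition is freeness, a deck transformation with a fixed point being
    trivial on idempotents. *)
Definition deck_transformation (g : eidx A' -> eidx A') (t : A' -> A') : Prop :=
  [/\ forall i, F (g i) = F i,
      forall a, pi (t a) = pi a,
      forall i a, left_corner i a -> left_corner (g i) (t a),
      forall j a, right_corner j a -> right_corner (g j) (t a)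
    & forall i j, g i = i -> g j = j].

(** A Galois covering of categories: [pi] restricts to bijections from
    [e_i A'] to [e_(F i) A]. It is multiplicative on composable pairs only, as
    idempotents of one fibre are orthogonal but have the same image. *)
Record covering_functor : Prop := CoveringFunctor {
  cf_lin : linear pi;
  cf_mul : forall j a b, right_corner j a -> left_corner j b ->
    pi (a ** b) = pi a ** pi b;
  cf_eid : forall i, pi (eid i) = eid (F i);
  cf_inj : forall i a, left_corner i a -> pi a = 0 -> a = 0;
  cf_surj : forall i y, left_corner (F i) y ->
    exists2 a, left_corner i a & pi a = y;
  cf_eps : forall i a, left_corner i a -> eps (F i) (pi a) = eps' i a;
  cf_onto : forall v, exists i, F i = v;
  cf_deck : forall i k, F i = F k ->
    exists g t, deck_transformation g t /\ g i = k }.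

Hypothesis cf : covering_functor.
Implicit Types (a b c n x z : A') (i j k l : eidx A').

Lemma cf_left i a : left_corner i a -> left_corner (F i) (pi a).
Proof.
move=> ia; have := cf_mul cf (left_corner_eid i) ia.
by rewrite ia (cf_eid cf).
Qed.

Lemma cf_right j a : right_corner j a -> right_corner (F j) (pi a).
Proof.
move=> ja; have := cf_mul cf ja (left_corner_eid j).
by rewrite ja (cf_eid cf).
Qed.

Lemma cf_left_inj i a b :
  left_corner i a -> left_corner i b -> pi a = pi b -> a = b.
Proof.
move=> ia ib ab; apply/eqP; rewrite -subr_eq0; apply/eqP/(cf_inj cf (i := i)).
  by rewrite /left_corner /= emulBr ia ib.
by rewrite (linB (cf_lin cf)) ab subrr.
Qed.

(** The inverse of [pi a] lifts to an element [b] of [e_i A'] with [a b = e_i];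
    only its component in [e_i A' e_i] is an inverse of [a]. *)
Lemma cf_augmented_local : augmented_local eps -> augmented_local eps'.
Proof.
move=> loc i a [la ra] a0.
have [|y [yl yr] [ay ya]] := loc (F i) (pi a) (conj (cf_left la) (cf_right ra)).
  by rewrite (cf_eps cf).
have [b lb yE] := cf_surj cf yl.
have ab : a ** b = eid i.
  apply: (cf_left_inj (left_cornerM _ la) (left_corner_eid i)).
  by rewrite (cf_mul cf ra lb) yE ay (cf_eid cf).
pose b' := b ** eid i; have lb' : left_corner i b' by exact: left_cornerM.
have ab' : a ** b' = eid i by rewrite emulA ab eid_idem.
exists b'; first by split=> //; exact: right_corner_mul.
split=> //; pose z := b' ** a - eid i.
have lz : left_corner i z.
  by rewrite /left_corner /= emulBr emulA lb' eid_idem.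
have az : a ** z = 0 by rewrite emulBr emulA ab' la ra subrr.
have : pi z = 0.
  rewrite -(cf_left lz) -ya -emulA -(cf_mul cf ra lz) az.
  by rewrite (lin0 (cf_lin cf)) emul0r.
by move/(cf_inj cf lz)/eqP; rewrite subr_eq0 => /eqP.
Qed.

Lemma cf_corner_fin_spanned i : fin_dim A -> fin_spanned (left_corner i).
Proof.
move=> [t tP].
have /choice[r rP] : forall k : nat,
    exists b, left_corner i b /\ pi b = eid (F i) ** t`_k.
  by move=> k; have [b] := cf_surj cf (left_corner_mul (F i) t`_k); exists b.
exists (mkseq r (size t)) => x ix; have [c cE] := tP (pi x) I.
have rE (k : 'I_(size t)) : (mkseq r (size t))`_k = r k by rewrite nth_mkseq.
exists c; rewrite size_mkseq; under eq_bigr => k _ do rewrite rE.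
apply: (cf_left_inj ix).
  rewrite /left_corner /= emul_sumr; apply: eq_bigr => k _.
  by have [h _] := rP k; rewrite emulZr h.
rewrite (lin_sum (cf_lin cf)) -(cf_left ix) cE emul_sumr; apply: eq_bigr => k _.
by have [_ h] := rP k; rewrite (linZ (cf_lin cf)) h emulZr.
Qed.

Lemma cf_socle_vector i j n : augmentation eps -> augmentation eps' ->
  socle_vector eps' i j n -> socle_vector eps (F i) (F j) (pi n).
Proof.
move=> aug aug' nS; have [n0 ni nE] := nS; have nj := socle_vector_right aug' nS.
split=> [||x]; first by apply: contraNneq n0 => /(cf_inj cf ni) ->.
  exact: cf_left.
have [r lr rE] := cf_surj cf (left_corner_mul (F j) x).
rewrite -{1}[pi n](cf_right nj) -emulA -rE -(cf_mul cf nj lr) nE (linZ (cf_lin cf)).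
congr (_ *: _); rewrite -(cf_eps cf lr) rE (epsM aug).
by rewrite (eps_eid1 aug) mul1r.
Qed.

(** As [pi] is multiplicative on composable pairs only, [pi x ** pi b] sums the
    images of the products of [x] with all translates of [b]; these end at
    different vertices, which makes the product with [b] itself recoverable. *)
Lemma cf_mul_component i j l x b : left_corner i x -> corner j l b ->
  exists z, [/\ left_corner i z, pi x ** pi b = pi z & z ** eid l = x ** b].
Proof.
move=> ix [jb bl]; have [s _ ->] := eid_sumr x.
rewrite (lin_sum (cf_lin cf)) !emul_suml.
pose P (y : A) (y' : A') :=
  exists z, [/\ left_corner i z, y = pi z & z ** eid l = y'].
apply: (big_ind2 P).
- by exists 0; rewrite /left_corner /= emul0l emul0r (lin0 (cf_lin cf)).
- move=> _ y' _ z' [y [iy -> yE]] [z [iz -> zE]]; exists (y + z).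
  by rewrite /left_corner /= emulDr iy iz (linD (cf_lin cf)) emulDl yE zE.
move=> k _; have xk : right_corner k (x ** eid k) := right_corner_mul k x.
have ixk : left_corner i (x ** eid k) by exact: left_cornerM.
have [kj|kj] := eqVneq k j.
  exists (x ** eid k ** b); split; first exact: left_cornerM.
    by rewrite (cf_mul cf xk) // kj.
  by rewrite -emulA bl.
have -> : x ** eid k ** b = 0 by rewrite -emulA (left_corner_orth jb kj) emul0r.
have [Fkj|Fkj] := eqVneq (F j) (F k); last first.
  exists 0; rewrite /left_corner /= emul0l emul0r (lin0 (cf_lin cf)); split=> //.
  rewrite -(cf_right xk) -emulA (left_corner_orth (cf_left jb)) ?emul0r //.
  by rewrite eq_sym.
have [g [t [[_ pit tl tr gfree] gj]]] := cf_deck cf Fkj.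
have ktb : left_corner k (t b) by rewrite -gj; exact: tl.
exists (x ** eid k ** t b); split; first exact: left_cornerM.
  by rewrite (cf_mul cf xk ktb) pit.
rewrite -emulA -(tr l b bl) -[t b ** _ ** _]emulA eid_orth.
case: eqP => [gl|_]; last by rewrite !emul0r.
by case/eqP: kj; rewrite -gj; apply: gfree gl.
Qed.

Hypotheses (aug : augmentation eps) (aug' : augmentation eps').
Hypothesis loc : augmented_local eps.
Hypothesis fdA : fin_dim A.
Variables (nu : eidx A -> eidx A) (w : eidx A -> A).
Hypothesis nuw : nakayama_socle eps nu w.

(** The preimage of [w (F i)] in [e_i A'] lies in a single corner: [e_i A']
    has a socle vector, which lies in one, and the simplicity of the socle of
    [e_(F i) A] makes its image proportional to [w (F i)]. *)
Lemma lifted_socle_vector i : exists j n, socle_vector eps' i j n /\ pi n = w (F i).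
Proof.
have [_ _ line _ _] := nuw.
have [j [b nS]] := socle_vector_exists aug' (cf_augmented_local loc)
  (cf_corner_fin_spanned i fdA) (left_corner_eid i) (eid_neq0 i).
have [c cE] := line _ _ _ (cf_socle_vector aug aug' nS).
move: {b} (eid i ** b) nS cE => n nS cE; have [n0 ni nE] := nS.
have c0 : c != 0.
  by apply: contraNneq n0 => c0; apply/eqP/(cf_inj cf ni); rewrite cE c0 scale0r.
exists j, (c^-1 *: n); split; last by rewrite (linZ (cf_lin cf)) cE scalerK.
split=> [||x]; first by rewrite scaler_eq0 invr_eq0 (negPf c0).
  by rewrite emulZr ni.
by rewrite emulZl nE !scalerA mulrC.
Qed.

Section LiftedForm.
Variables (nu' : eidx A' -> eidx A') (w' : eidx A' -> A').
Hypothesis w'S : forall i, socle_vector eps' i (nu' i) (w' i).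
Hypothesis w'E : forall i, pi (w' i) = w (F i).

Let w'l i : left_corner i (w' i). Proof. by have [_ + _] := w'S i. Qed.
Let w'r i : right_corner (nu' i) (w' i).
Proof. rewrite /right_corner /=; exact: (socle_vector_right aug' (w'S i)). Qed.
Let w'0 i : w' i != 0. Proof. by have [+ _ _] := w'S i. Qed.

Lemma lifted_target_uniq i j : right_corner j (w' i) -> j = nu' i.
Proof.
move=> wj; apply/eqP/negPn/negP => ji; case/eqP: (w'0 i).
by rewrite -wj -(w'r i) -emulA eid_orth eq_sym (negPf ji) emul0r.
Qed.

Lemma lifted_target_image i : F (nu' i) = nu (F i).
Proof.
have [_ wS _ _ _] := nuw; have [w0 _ wE] := wS (F i).
have := cf_right (w'r i); rewrite /right_corner /= w'E wE (eps_eid aug).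
case: eqP => // _ /esym/eqP; rewrite scale0r => w00.
by rewrite w00 in w0.
Qed.

Lemma lifted_target_deck g t i :
  deck_transformation g t -> nu' (g i) = g (nu' i).
Proof.
move=> [Fg pit tl tr _]; apply/esym/lifted_target_uniq.
have -> : w' (g i) = t (w' i); last exact/tr/w'r.
apply: (cf_left_inj (w'l _)); first exact/tl/w'l.
by rewrite pit !w'E Fg.
Qed.

(** [nu'] lifts the permutation [nu] and commutes with the deck transformations,
    which act simply transitively on each fibre. *)
Lemma lifted_target_bij : bijective nu'.
Proof.
have [[nu_inj nu_onto] _ _ _ _] := nuw.
have nu'_inj : injective nu'.
  move=> i k ik; have Fik : F i = F k.
    by apply: nu_inj; rewrite -!lifted_target_image ik.
  have [g [t [gt gi]]] := cf_deck cf Fik.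
  rewrite -gi; apply/esym; have [_ _ _ _ gfree] := gt.
  apply: (gfree (nu' i)); rewrite -(lifted_target_deck i gt) gi.
  by rewrite ik.
have /choice[h hK] : forall j, exists i, nu' i = j.
  move=> j; have [v vj] := nu_onto (F j); have [i iv] := cf_onto cf v.
  have Fij : F (nu' i) = F j by rewrite lifted_target_image iv.
  have [g [t [gt gi]]] := cf_deck cf Fij.
  by exists (g i); rewrite (lifted_target_deck i gt).
by exists h => // i; apply: nu'_inj.
Qed.

Lemma lifted_right_multiple i j a : corner i j a -> a != 0 ->
  exists2 b, corner j (nu' i) b & a ** b = w' i.
Proof.
have [_ _ _ right_mul _] := nuw => -[ia aj] a0.
have [|y yE] := right_mul (F i) (pi a) (cf_left ia).
  by apply: contraNneq a0 => /(cf_inj cf ia) ->.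
have [b jb bE] := cf_surj cf (left_corner_mul (F j) y).
exists (b ** eid (nu' i)).
  by split; [exact: left_cornerM | exact: right_corner_mul].
rewrite emulA (_ : a ** b = w' i); first exact: w'r.
apply: (cf_left_inj (left_cornerM _ ia) (w'l i)).
by rewrite (cf_mul cf aj jb) bE emulA (cf_right aj) yE w'E.
Qed.

Lemma lifted_left_multiple i j b : corner j (nu' i) b -> b != 0 ->
  exists2 a, corner i j a & a ** b = w' i.
Proof.
have [_ wS _ _ left_mul] := nuw => -[jb bi] b0.
have [||y yE] := left_mul (F i) (F j) (pi b).
- by split; [exact: cf_left | rewrite -lifted_target_image; exact: cf_right].
- by apply: contraNneq b0 => /(cf_inj cf jb) ->.
have [x ix xE] := cf_surj cf (left_corner_mul (F i) y).
have [z [iz zE zi]] := cf_mul_component ix (conj jb bi).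
have zw : z = w' i.
  apply: (cf_left_inj iz (w'l i)).
  by rewrite -zE xE -emulA yE w'E; have [_ ->] := wS (F i).
exists (x ** eid j).
  by split; [exact: left_cornerM | exact: right_corner_mul].
by rewrite -emulA jb -zi zw; exact: w'r.
Qed.

(** The form evaluates, on a product in [e_i A'], the component ending at
    [nu' i] by a functional that takes the value 1 on the socle generator. *)
Lemma lifted_nakayama_form : exists f, nakayama_form f nu'.
Proof.
have [_ wS _ _ _] := nuw.
have /choice[lam lamP] : forall v, exists lam : A -> K,
    linear_for *%R lam /\ lam (w v) = 1.
  move=> v; have [w0 _ _] := wS v; have [lam] := functional_exists w0.
  by exists lam.
have lamL v : linear (lam v : A -> K^o) by have [h _] := lamP v; exact: h.
have [i c x y|L L_lin LE] :=
  @glue_left K A' K^o (fun i x => lam (F i) (pi (x ** eid (nu' i)))).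
  by rewrite emul_linl (cf_lin cf) lamL.
have Lw i : L (w' i) = 1.
  by rewrite (LE i) // (w'r i) w'E; have [_ ->] := lamP (F i).
exists (fun a b => L (a ** b)); split.
- split=> [b c x y|a c x y] /=; rewrite ?emul_linl ?emul_linr; exact: L_lin.
- by move=> a b c; rewrite emulA.
- move=> i k; split=> [[a [b [ia bk ab]]]|->].
    apply/eqP; apply: contraNT ab => ki.
    rewrite (LE i _ (left_cornerM b ia)) -bk -!emulA eid_orth (negPf ki).
    by rewrite !emul0r (lin0 (cf_lin cf)) (lin0 (lamL _)).
  exists (eid i), (w' i); split; [exact: left_corner_eid | exact: w'r |].
  by rewrite (w'l i) Lw oner_eq0.
- exact: lifted_target_bij.
move=> i j; split=> [a ca aN|b cb bN]; apply: contrapT => /eqP.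
  by move/(lifted_right_multiple ca)=> [b cb ab]; have := aN b cb;
    rewrite ab Lw => /eqP; rewrite oner_eq0.
by move/(lifted_left_multiple cb)=> [a ca ab]; have := bN a ca;
  rewrite ab Lw => /eqP; rewrite oner_eq0.
Qed.

End LiftedForm.

Lemma covering_pseudo_frobenius : pseudo_frobenius A'.
Proof.
split.
- by move=> i j; have [t tP] := cf_corner_fin_spanned i fdA; exists t => x [/tP].
- exact: (augmented_local_weakly_basic aug' (cf_augmented_local loc)).
have /choice[p pP] : forall i, exists p : eidx A' * A',
    socle_vector eps' i p.1 p.2 /\ pi p.2 = w (F i).
  by move=> i; have [j [n ?]] := lifted_socle_vector i; exists (j, n).
have [f fP] := lifted_nakayama_form (fun i => proj1 (pP i)) (fun i => proj2 (pP i)).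
by exists f, (fun i => (p i).1).
Qed.

End Coverings.

(** * Finite-dimensional pseudo-Frobenius algebras *)

Section PseudoFrobenius.
Variables (K : fieldType) (A : ealgebra K).
Variables (f : A -> A -> K) (nu : eidx A -> eidx A).
Hypothesis ff : nakayama_form f nu.
Implicit Types (a b c x : A) (i j k : eidx A).

Lemma nakayama_linl b : linear (f^~ b : A -> K^o).
Proof. by have [[h _] _ _ _ _] := ff; exact: h. Qed.
Lemma nakayama_linr a : linear (f a : A -> K^o).
Proof. by have [[_ h] _ _ _ _] := ff; exact: h. Qed.
Lemma nakayamaA a b c : f (a ** b) c = f a (b ** c).
Proof. by have [_ h _ _ _] := ff; exact: h. Qed.

(** The form vanishes between [e_k A] and [A e_(nu i)] unless [k = i]. *)
Lemma nakayama_component i a c :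
  right_corner (nu i) c -> f (eid i ** a) c = f a c.
Proof.
move=> ci; apply: (@linear_left_ext K A K^o (fun a => f (eid i ** a) c) (f^~ c)).
- by move=> t x y; rewrite emul_linr nakayama_linl.
- exact: nakayama_linl.
move=> k x kx; have [ik|ik] := eqVneq i k; first by rewrite ik kx.
rewrite (left_corner_orth kx ik) (lin0 (nakayama_linl c)).
apply/esym/eqP/negPn/negP => xc; have [_ _ h nu_bij _] := ff.
have : nu i = nu k by apply/h; exists x, c.
by move/(bij_inj nu_bij)/eqP; rewrite (negPf ik).
Qed.

Lemma nakayama_nondegenerate b : (forall x, f b x = 0) -> b = 0.
Proof.
move=> bN; apply/eqP/negPn/negP => /left_component_neq0[i].
move/right_component_neq0=> [j] /eqP; apply.
have [_ _ _ _ h] := ff; have [+ _] := h i j; apply; first exact: corner_mul.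
by move=> c [jc ci]; rewrite nakayamaA jc nakayama_component // bN.
Qed.

(** With respect to a basis, injectivity of [b |-> f b] makes the Gram matrix
    invertible. *)
Lemma nakayama_riesz (psi : A -> K) : fin_dim A -> linear_for *%R psi ->
  exists b, forall x, f b x = psi x.
Proof.
move=> fd psi_lin; have psiL : linear (psi : A -> K^o) by exact: psi_lin.
have [n [x [x_ind xP]]] := basis_exists fd.
pose G := \matrix_(k < n, l < n) f (x k) (x l).
pose c (u : 'rV[K]_n) (k : nat) := if insub k is Some i then u 0 i else 0.
have cE u (k : 'I_n) : c u k = u 0 k by rewrite /c valK.
have fG u (l : 'I_n) : f (comb n x (c u)) (x l) = (u *m G) 0 l.
  rewrite /comb (lin_sum (nakayama_linl _)) mxE; apply: eq_bigr => k _.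
  by rewrite (linZ (nakayama_linl _)) cE mxE.
have ext u (phi : A -> K^o) : linear phi ->
    (forall l : 'I_n, (u *m G) 0 l = phi (x l)) ->
    forall y, f (comb n x (c u)) y = phi y.
  move=> phi_lin uG y; have [d ->] := xP y.
  rewrite {2 3}/comb (lin_sum (nakayama_linr _)) (lin_sum phi_lin).
  apply: eq_bigr => l _.
  by rewrite (linZ (nakayama_linr _)) (linZ phi_lin) fG uG.
have G_unit : G \in unitmx.
  rewrite -row_free_unit -kermx_eq0; apply/rowV0P => u /sub_kermxP uG.
  have u0 : comb n x (c u) = 0.
    apply/nakayama_nondegenerate/(ext u (fun=> 0)) => [t y z|l].
      by rewrite scaler0 addr0.
    by rewrite uG mxE.
  by apply/rowP => k; rewrite mxE -cE; apply: x_ind.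
exists (comb n x (c ((\row_l psi (x l)) *m invmx G))).
by apply: ext => // l; rewrite mulmxKV // mxE.
Qed.

(** A homomorphism [h] to the regular module corresponds to the functional
    [m |-> f (h m) 1]; extending the functional extends [h]. *)
Lemma nakayama_self_injective : fin_dim A -> self_injective A.
Proof.
move=> fd M N u h [u_lin uM] u_inj [h_lin hM].
have [L uL LP] := fin_dim_indices fd.
pose e : A := \sum_(i <- L) eid i.
have hL : linear (fun m => f (h m) e : K^o).
  by move=> c m n; rewrite h_lin nakayama_linl.
have [Th ThL ThE] := @extend_linear K M N K^o u _ u_lin u_inj hL.
have /choice[g gE] : forall n, exists b, forall x, f b x = Th (ract n x).
  move=> n; apply: (nakayama_riesz fd) => c x y.
  by rewrite ract_linr ThL.
have g_uniq n b : (forall x, f b x = Th (ract n x)) -> g n = b.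
  move=> bE; apply/eqP; rewrite -subr_eq0; apply/eqP/nakayama_nondegenerate => x.
  by rewrite (linB (nakayama_linl x)) gE bE subrr.
exists g; first split.
- move=> c n n'; apply: g_uniq => x.
  by rewrite ract_linl ThL -!gE nakayama_linl.
- by move=> n a; apply: g_uniq => x; rewrite ractA nakayamaA gE.
move=> m; apply: g_uniq => x.
have hMx : h (ract m x) = h m ** x := hM m x.
by rewrite -uM ThE hMx nakayamaA unit_sum.
Qed.

End PseudoFrobenius.

(** * Path algebras modulo relations *)

Lemma malg_eq_bilin (K : fieldType) (S T : choiceType) (V : lmodType K)
    (f g : {malg K[S]} -> {malg K[T]} -> V) :
  (forall y, linear (f^~ y)) -> (forall x, linear (f x)) ->
  (forall y, linear (g^~ y)) -> (forall x, linear (g x)) ->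
  (forall p q, f << p >> << q >> = g << p >> << q >>) -> forall x y, f x y = g x y.
Proof.
move=> fl fr gl gr fg x y.
apply: (malg_eq_lin (fl y) (gl y)) => p {x}.
exact: (malg_eq_lin (fr << p >>) (gr << p >>)).
Qed.

Section PathComponents.
Variables (K : fieldType) (Q : quiver).
Local Notation P := (path_algebra K Q).
Implicit Types (v : eidx P) (p q : qpath Q) (x : P).

Lemma eid_path v p : eid v ** (<< p >> : P) = if v == psrc p then << p >> else 0.
Proof. by rewrite /emul /= kqmulU pmul_trivl. Qed.

Lemma path_eid v p : (<< p >> : P) ** eid v = if ptgt p == v then << p >> else 0.
Proof. by rewrite /emul /= kqmulU pmul_trivr. Qed.

Lemma path_mul p q : (<< p >> : P) ** (<< q >> : P) = pmul K p q.
Proof. exact: kqmulU. Qed.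

Lemma path_expansion x :
  x = \sum_(p <- msupp (x : {malg K[qpath Q]}))
    (x : {malg K[qpath Q]})@_p *: (<< p >> : P).
Proof. by rewrite -[LHS]lin_ext_id. Qed.

Lemma eid_mul_supported v w x :
  (forall p, p \in msupp (x : {malg K[qpath Q]}) -> psrc p = w) ->
  eid v ** x = if v == w then x else 0.
Proof.
move=> xw; have E p : p \in msupp (x : {malg K[qpath Q]}) ->
    eid v ** (<< p >> : P) = if v == w then << p >> else 0.
  by move=> /xw <-; exact: eid_path.
transitivity (\sum_(p <- msupp (x : {malg K[qpath Q]}))
    (x : {malg K[qpath Q]})@_p *: (if v == w then << p >> else 0 : P)).
  rewrite {1}[x]path_expansion emul_sumr; apply: eq_big_seq => p px.
  by rewrite emulZr (E p px).
case: (v == w); first by rewrite -path_expansion.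
by apply: big1 => p _; rewrite scaler0.
Qed.

Lemma mul_eid_supported v w x :
  (forall p, p \in msupp (x : {malg K[qpath Q]}) -> ptgt p = w) ->
  x ** eid v = if w == v then x else 0.
Proof.
move=> xw; have E p : p \in msupp (x : {malg K[qpath Q]}) ->
    (<< p >> : P) ** eid v = if w == v then << p >> else 0.
  by move=> /xw <-; exact: path_eid.
transitivity (\sum_(p <- msupp (x : {malg K[qpath Q]}))
    (x : {malg K[qpath Q]})@_p *: (if w == v then << p >> else 0 : P)).
  rewrite {1}[x]path_expansion emul_suml; apply: eq_big_seq => p px.
  by rewrite emulZl (E p px).
case: (w == v); first by rewrite -path_expansion.
by apply: big1 => p _; rewrite scaler0.
Qed.

End PathComponents.

Section PathMaps.
Variables (K : fieldType) (Q' Q : quiver) (F : qmorph Q' Q).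
Local Notation P' := (path_algebra K Q').
Local Notation P := (path_algebra K Q).

Lemma kq_map_lin : linear (kq_map F : P' -> P).
Proof. exact: lin_ext_is_linear. Qed.

Lemma kq_mapU p : kq_map F << p >> = << path_map F p >> :> {malg K[qpath Q]}.
Proof. exact: lin_extU. Qed.

Lemma path_map_triv v : path_map F (triv v) = triv (F v).
Proof. exact: qpath_inj. Qed.

Lemma ptgt_path_map p : ptgt (path_map F p) = F (ptgt p).
Proof.
rewrite /ptgt [psrc (path_map F p)]/(F (psrc p)).
rewrite [parrs (path_map F p)]/([seq qma F a | a <- parrs p]) -map_comp.
by rewrite -(last_map F) -map_comp; congr last; apply: eq_map => a; exact: qm_tgt.
Qed.

Lemma kq_map_path_mul (j : vert Q') p q : ptgt p = j -> psrc q = j ->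
  kq_map F (pmul K p q) = pmul K (path_map F p) (path_map F q).
Proof.
move=> pj qj; rewrite /pmul; case: pcatP => [r _ rp rE|]; last by rewrite pj qj.
rewrite kq_mapU; case: pcatP => [s _ sp sE|].
  congr << _ >>; apply: qpath_inj; first by rewrite sp /psrc /= -/(psrc r) rp.
  by rewrite sE /parrs /= -/(parrs r) rE map_cat.
by rewrite ptgt_path_map pj; case; rewrite /psrc /= -/(psrc q) qj.
Qed.

(** Only for composable pairs: the images of two paths may be composable
    without the paths being so. *)
Lemma kq_map_mul j (a b : P') : right_corner j a -> left_corner j b ->
  kq_map F (a ** b) = (kq_map F a : P) ** kq_map F b.
Proof.
suff H (x y : P') : kq_map F ((x ** eid j) ** (eid j ** y)) =
    (kq_map F (x ** eid j) : P) ** kq_map F (eid j ** y).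
  by move=> aj bj; have := H a b; rewrite aj bj.
have L := kq_map_lin.
apply: (malg_eq_bilin
  (f := fun x y : P' => kq_map F ((x ** eid j) ** (eid j ** y)) : P)
  (g := fun x y : P' => (kq_map F (x ** eid j) : P) ** kq_map F (eid j ** y))).
- by move=> z c u v; rewrite !emul_linl L.
- by move=> z c u v; rewrite !emul_linr L.
- by move=> z c u v; rewrite emul_linl L emul_linl.
- by move=> z c u v; rewrite emul_linr L emul_linr.
move=> p q; have H (X Y : P') : X = (if ptgt p == j then << p >> else 0) ->
    Y = (if j == psrc q then << q >> else 0) ->
    kq_map F (X ** Y) = (kq_map F X : P) ** kq_map F Y.
  case: eqP => [pj|_] ->; last by rewrite emul0l (lin0 L) emul0l.
  case: eqP => [jq|_] ->; last by rewrite emul0r (lin0 L) emul0r.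
  apply: etrans (congr1 (kq_map F) (path_mul K p q)) _.
  rewrite (kq_map_path_mul pj (esym jq)).
  apply: esym; apply: etrans _ (path_mul K _ _).
  exact: (@emul_congr K P) (kq_mapU p) (kq_mapU q).
exact: H (path_eid j p) (eid_path j q).
Qed.

(** A path with trivial image is trivial; starting at [i], it is the trivial
    path at [i]. *)
Lemma kq_map_coeff (i : eidx P') (x : P') :
  (kq_map F (eid i ** x) : {malg K[qpath Q]})@_(triv (F i)) =
  (x : {malg K[qpath Q']})@_(triv i).
Proof.
have L := kq_map_lin.
apply: (@malg_eq_lin K _ K^o
  (fun x : P' => (kq_map F (eid i ** x) : {malg K[qpath Q]})@_(triv (F i)))
  (fun x : P' => (x : {malg K[qpath Q']})@_(triv i))).
- by move=> c u v; rewrite emul_linr L mcoeffD mcoeffZ.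
- by move=> c u v; rewrite mcoeffD mcoeffZ.
move=> p; rewrite eid_path mcoeffU; case: eqP => [ip|ip]; last first.
  rewrite (lin0 L) mcoeff0; case: eqP => // pi.
  by case: ip; rewrite pi.
rewrite kq_mapU mcoeffU; congr (_ %:R); congr nat_of_bool.
apply/eqP/eqP => [|->]; last exact: path_map_triv.
move/(congr1 (@parrs Q)); rewrite /parrs /= -/(parrs p) => pE.
by apply: qpath_inj => //=; move: pE; case: (parrs p).
Qed.

End PathMaps.

Section BoundQuivers.
Variable K : fieldType.
Implicit Types Q : rquiver K.

Lemma kq_map_rel_ideal Q' Q (F : qmorph Q' Q) x : rel_morph F ->
  submod_set (rel_ideal Q') x -> submod_set (rel_ideal Q) (kq_map F x).
Proof.
move=> Frel xI; have [S0 SD SZ] := submodP (rel_ideal Q).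
have [_ SM] := rel_ideal_ideal Q.
have L := kq_map_lin (K := K) F.
have Ssum (J : Type) (s : seq J) (G : J -> path_algebra K Q) :
    (forall k, submod_set (rel_ideal Q) (G k)) ->
    submod_set (rel_ideal Q) (\sum_(k <- s) G k).
  by move=> GS; apply: big_ind.
(* The preimage of the ideal need not be an ideal, as the map is not
   multiplicative: the condition is imposed on each corner separately. *)
pose I0 : set (path_algebra K Q') := fun x => forall i j,
  submod_set (rel_ideal Q) (kq_map F (eid i ** x ** eid j)).
have I0x : I0 x.
  apply: xI; first split; first split.
  - by move=> i j; rewrite emul0r emul0l (lin0 L).
  - move=> y z yI zI i j; rewrite emulDr emulDl (linD L); exact: SD.
  - move=> c y yI i j; rewrite emulZr emulZl (linZ L); exact: SZ.
  - move=> y a yI; split=> i j.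
      have [s _ yE] := eid_suml y.
      rewrite yE emul_sumr emul_sumr emul_suml (lin_sum L); apply: Ssum => k.
      rewrite (emulA a) -corner_product.
      have [_ r] := corner_mul i k a; have [l _] := corner_mul k j y.
      by rewrite (kq_map_mul F r l); exact: (SM _ _ (yI k j)).1.
    have [s _ yE] := eid_sumr y.
    rewrite yE emul_suml emul_sumr emul_suml (lin_sum L); apply: Ssum => k.
    rewrite -corner_product.
    have [_ r] := corner_mul i k y; have [l _] := corner_mul k j a.
    by rewrite (kq_map_mul F r l); exact: (SM _ _ (yI i k)).2.
  move=> r rR i j; have [i0 [j0 rP]] := relsP rR.
  have lE : (eid i : path_algebra K Q') ** r = if i == i0 then r else 0.
    by apply: eid_mul_supported => p /rP[].
  have rE : (r : path_algebra K Q') ** eid j = if j0 == j then r else 0.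
    by apply: mul_eid_supported => p /rP[].
  have [<-|ij] := pselect (r = (eid i : path_algebra K Q') ** r ** eid j).
    exact: Frel.
  suff -> : (eid i : path_algebra K Q') ** r ** eid j = 0 by rewrite (lin0 L).
  move: ij; rewrite lE; case: (i == i0); last by rewrite emul0l.
  by rewrite rE; case: (j0 == j).
have [s _ ->] := eid_suml (x : path_algebra K Q').
rewrite (lin_sum L); apply: (Ssum) => i.
have [t _ ->] := eid_sumr (eid i ** x : path_algebra K Q').
by rewrite (lin_sum L); apply: Ssum => j; exact: I0x.
Qed.

(** The elements without constant terms form an ideal, which contains the
    relations because these involve paths of length at least 2 only. *)
Lemma rel_ideal_coeff Q x v :
  submod_set (rel_ideal Q) x -> (x : {malg K[qpath Q]})@_(triv v) = 0.
Proof.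
pose I : set (path_algebra K Q) :=
  [set x | forall w, (x : {malg K[qpath Q]})@_(triv w) = 0]%classic.
move=> xI; apply: (xI I); last first.
  move=> r /relsP[i [j rP]] w; apply: mcoeff_outdom.
  by apply/negP => /rP[_ _]; rewrite /plen.
split; first split.
- by move=> w; rewrite mcoeff0.
- by move=> y z Iy Iz w; rewrite mcoeffD Iy Iz addr0.
- by move=> c y Iy w; rewrite mcoeffZ Iy mulr0.
by move=> y a Iy; split=> w; rewrite mcoeff_kqmul Iy ?mulr0 ?mul0r.
Qed.

Lemma rq_proj_lin Q :
  linear (@rq_proj K Q : path_algebra K Q -> rq_algebra Q).
Proof. exact: qproj_is_linear. Qed.

Lemma rq_projM Q (a b : path_algebra K Q) :
  rq_proj (a ** b) = rq_proj a ** rq_proj b.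
Proof. by rewrite {2}/emul /= qmul_proj //; exact: rel_ideal_ideal. Qed.

Lemma rq_proj_eid Q (v : vert Q) :
  rq_proj (@eid K (path_algebra K Q) v) = @eid K (rq_algebra Q) v.
Proof. by []. Qed.

Lemma rq_projK Q (a : rq_algebra Q) : rq_proj (rq_repr a) = a.
Proof. exact: qreprK. Qed.

Lemma rq_repr_proj Q (x : path_algebra K Q) :
  submod_set (rel_ideal Q) (rq_repr (rq_proj x) - x).
Proof. by apply/(qprojP (rel_ideal Q)); rewrite qreprK. Qed.

Definition rq_eps Q (v : eidx (rq_algebra Q)) (a : rq_algebra Q) : K :=
  (rq_repr a)@_(triv v).

Lemma rq_eps_proj Q (v : vert Q) (x : path_algebra K Q) :
  rq_eps v (rq_proj x) = (x : {malg K[qpath Q]})@_(triv v).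
Proof.
apply/eqP; rewrite -subr_eq0 -mcoeffB; apply/eqP/rel_ideal_coeff.
exact: rq_repr_proj.
Qed.

Lemma rq_eps_augmentation Q : augmentation (@rq_eps Q).
Proof.
split=> [v c a b|v a b|v w].
- rewrite -[a]rq_projK -[b]rq_projK -rq_proj_lin !rq_eps_proj.
  by rewrite mcoeffD mcoeffZ.
- by rewrite -[a]rq_projK -[b]rq_projK -rq_projM !rq_eps_proj mcoeff_kqmul.
rewrite -rq_proj_eid rq_eps_proj mcoeffU.
by rewrite eq_sym (inj_eq (f := @triv Q)) // => x y /(congr1 (@psrc Q)).
Qed.

Section InducedMap.
Variables (Q' Q : rquiver K) (F : qmorph Q' Q).
Hypothesis Frel : rel_morph F.

Lemma rq_map_proj (x : path_algebra K Q') :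
  rq_map F (rq_proj x) = rq_proj (kq_map F x) :> rq_algebra Q.
Proof.
apply/(qprojP (rel_ideal Q)); rewrite -(linB (kq_map_lin F)).
apply: kq_map_rel_ideal => //; exact: rq_repr_proj.
Qed.

Lemma rq_map_lin : linear (@rq_map K Q' Q F).
Proof.
move=> c a b; rewrite -[a]rq_projK -[b]rq_projK -rq_proj_lin !rq_map_proj.
by rewrite (kq_map_lin F) rq_proj_lin.
Qed.

Lemma rq_map_mul (j : eidx (rq_algebra Q')) (a b : rq_algebra Q') :
  right_corner j a -> left_corner j b ->
  rq_map F (a ** b) = rq_map F a ** rq_map F b.
Proof.
move=> aj jb; pose j0 : eidx (path_algebra K Q') := j.
pose x := (rq_repr a : path_algebra K Q') ** eid j0.
pose y := eid j0 ** (rq_repr b : path_algebra K Q').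
have -> : a = rq_proj x by rewrite rq_projM rq_projK rq_proj_eid.
have -> : b = rq_proj y by rewrite rq_projM rq_projK rq_proj_eid.
have xj : right_corner j0 x := right_corner_mul j0 _.
have jy : left_corner j0 y := left_corner_mul j0 _.
apply: etrans (congr1 (rq_map F) (esym (rq_projM x y))) _.
apply: etrans (rq_map_proj (x ** y)) _; rewrite (kq_map_mul F xj jy).
apply: etrans (rq_projM _ _) _.
exact: emul_congr (esym (rq_map_proj x)) (esym (rq_map_proj y)).
Qed.

Lemma rq_map_eid (i : eidx (rq_algebra Q')) :
  rq_map F (eid i) = eid (F i : eidx (rq_algebra Q)).
Proof.
by rewrite -!rq_proj_eid rq_map_proj /= /kqid kq_mapU path_map_triv.
Qed.

Lemma rq_map_left (i : eidx (rq_algebra Q')) (a : rq_algebra Q') :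
  left_corner i a -> left_corner (F i : eidx (rq_algebra Q)) (rq_map F a).
Proof.
move=> ia; have := rq_map_mul (left_corner_eid i) ia.
by rewrite ia rq_map_eid.
Qed.

Lemma rq_map_right (i : eidx (rq_algebra Q')) (a : rq_algebra Q') :
  right_corner i a -> right_corner (F i : eidx (rq_algebra Q)) (rq_map F a).
Proof.
move=> ia; have := rq_map_mul ia (left_corner_eid i).
by rewrite ia rq_map_eid.
Qed.

Lemma rq_map_eps (i : eidx (rq_algebra Q')) (a : rq_algebra Q') :
  left_corner i a -> rq_eps (F i : eidx (rq_algebra Q)) (rq_map F a) = rq_eps i a.
Proof.
move=> ia; pose x : path_algebra K Q' := rq_repr a.
pose i0 : eidx (path_algebra K Q') := i.
have {1}<- : rq_proj (eid i0 ** x) = a by rewrite rq_projM rq_projK rq_proj_eid.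
by rewrite rq_map_proj rq_eps_proj kq_map_coeff.
Qed.

End InducedMap.

Lemma path_map_ext (Q' Q : quiver) (F G : qmorph Q' Q) :
  qmorph_eq F G -> path_map F =1 path_map G.
Proof.
move=> [Fv Fa] p; apply: qpath_inj; first by rewrite /psrc /= Fv.
by rewrite /parrs /=; apply: eq_map => a; rewrite Fa.
Qed.

Lemma kq_map_ext (Q' Q : quiver) (F G : qmorph Q' Q) :
  qmorph_eq F G -> @kq_map K _ _ F =1 kq_map G.
Proof.
move=> FG; apply: malg_eq_lin; try exact: lin_ext_is_linear.
by move=> p; rewrite !kq_mapU (path_map_ext FG).
Qed.

Lemma rq_map_id Q (F : qmorph Q Q) (a : rq_algebra Q) :
  qmorph_eq F (qmorph_id Q) -> rq_map F a = a.
Proof.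
move=> F1; rewrite /rq_map (kq_map_ext F1) -[RHS]rq_projK; congr rq_proj.
apply: (malg_eq_lin (f := kq_map (qmorph_id Q)) (g := id)) => //.
  exact: lin_ext_is_linear.
move=> p; rewrite kq_mapU; congr << _ >>; apply: qpath_inj => //.
by rewrite /parrs /= map_id.
Qed.

Lemma rq_map_comp Q1 Q2 Q3 (F : qmorph Q2 Q3) (G : qmorph Q1 Q2) (H : qmorph Q1 Q3)
    (a : rq_algebra Q1) : rel_morph F -> qmorph_eq H (qmorph_comp F G) ->
  rq_map F (rq_map G a) = rq_map H a.
Proof.
move=> Frel HFG; rewrite {2}/rq_map rq_map_proj // /rq_map (kq_map_ext HFG).
congr rq_proj.
apply: (malg_eq_lin (f := fun x => kq_map F (kq_map G x))
  (g := kq_map (qmorph_comp F G))).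
- by move=> c x y; rewrite !kq_map_lin.
- exact: lin_ext_is_linear.
move=> p; rewrite !kq_mapU; congr << _ >>; apply: qpath_inj => //.
by rewrite /parrs /= -map_comp.
Qed.

End BoundQuivers.

(** * Coverings of quivers with relations *)

Section CoveringQuivers.
Variables (K : fieldType) (Q' Q : rquiver K) (F : qmorph Q' Q).
Hypothesis Frel : rel_morph F.
Variables (G : groupType) (act : G -> qmorph Q' Q').
Let acta g := @rq_map K Q' Q' (act g).
Hypothesis free : free_action act.
Hypothesis F_onto : forall v : vert Q, exists i, F i = v.
Hypothesis F_fibre : forall i j, F i = F j <-> exists g, act g i = j.
Variable phi : orbit_space acta -> rq_algebra Q.
Hypothesis phi_bij : bijective phi.
Hypothesis phiE : forall a, phi (orbit_class acta a) = rq_map F a.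
Local Notation A' := (rq_algebra Q').
Local Notation A := (rq_algebra Q).
Implicit Types (g h : G) (i j k : vert Q').

Lemma actM g h i : act (g * h)%g i = act g (act h i).
Proof. by have [E _] := fa_mul free g h; rewrite E. Qed.

Lemma act1 i : act 1%g i = i.
Proof. by have [E _] := fa_one free; rewrite E. Qed.

Lemma act_inj_group g h i : act g i = act h i -> g = h.
Proof.
move=> gh; apply: contrapT => ngh.
apply: (@fa_free _ _ _ _ free (h^-1 * g)%g i).
  by move=> e; apply: ngh; rewrite -[g](mulVKg h) e mulg1.
by rewrite actM gh -actM mulVg act1.
Qed.

Lemma rq_map_deck g a : rq_map F (acta g a) = rq_map F a.
Proof.
rewrite -!phiE; congr phi; apply/esym/qprojP => S _; apply.
by exists g, a.
Qed.

(** [transport k i] moves [e_k A'] to [e_i A'] along the element of the group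
    taking [k] to [i], which is unique by freeness. *)
Definition transport k i (x : A') : A' :=
  if pselect (exists g, act g k = i) is left e then acta (projT1 (cid e)) x else 0.

Lemma transportE g k i x : act g k = i -> transport k i x = acta g x.
Proof.
move=> gki; rewrite /transport; case: pselect => [e|[]]; last by exists g.
case: (cid e) => h hki /=; congr (acta _ x).
by apply: (@act_inj_group _ _ k); rewrite hki.
Qed.

Lemma transport_lin k i : linear (transport k i).
Proof.
move=> c x y; rewrite /transport.
case: pselect => [e|_]; last by rewrite scaler0 addr0.
exact: (rq_map_lin (fa_rel free _)).
Qed.

(** The transports to [i] glue to a map that sums the translates starting at
    [i]: an inverse, on orbits, of the inclusion of [e_i A']. *)
Lemma orbit_section i : exists D : A' -> A',
  [/\ linear D, forall a, left_corner (i : eidx A') a -> D a = a,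
      forall g a, D (acta g a) = D a, forall a, left_corner (i : eidx A') (D a)
    & forall a, rq_map F (D a) = eid (F i : eidx A) ** rq_map F a].
Proof.
have [D D_lin DE] := @glue_left K A' A' (fun k => transport k i)
  (fun k => transport_lin k i).
have acta_lin g : linear (acta g) by exact: (rq_map_lin (fa_rel free _)).
have acta_left g k a : left_corner (k : eidx A') a ->
    left_corner (act g k : eidx A') (acta g a).
  exact: (rq_map_left (fa_rel free _)).
exists D; split=> //.
- move=> a ia; rewrite (DE _ _ ia) (transportE _ (act1 i)).
  exact: rq_map_id (fa_one free).
- move=> g; apply: linear_left_ext => // [c x y|k a ka].
    by rewrite acta_lin D_lin.
  rewrite (DE _ _ ka) (DE _ _ (acta_left g _ _ ka)).
  have [[h hgk]|N] := pselect (exists h, act h (act g k) = i); last first.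
    rewrite /transport; case: pselect => // _; case: pselect => // -[h hk].
    by case: N; exists (h * g^-1)%g; rewrite -actM mulgVK.
  apply: etrans (transportE _ hgk) _.
  apply: etrans _ (esym (transportE _ (etrans (actM h g k) hgk))).
  exact: rq_map_comp (fa_rel free h) (fa_mul free h g).
- apply: linear_left_ext => // [c x y|k a ka]; first by rewrite D_lin emul_linr.
  rewrite (DE _ _ ka) /transport; case: pselect => [e|_]; last by rewrite emul0r.
  by case: (cid e) => g /= <-; exact: acta_left.
apply: linear_left_ext => [c x y|c x y|k a ka].
- by rewrite D_lin (rq_map_lin Frel).
- by rewrite (rq_map_lin Frel) emul_linr.
have kFa := rq_map_left Frel ka.
rewrite (DE _ _ ka) /transport; case: pselect => [e|N].
  by have /F_fibre <- := e; rewrite rq_map_deck kFa.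
rewrite (lin0 (rq_map_lin Frel)) (left_corner_orth kFa) //.
by apply/eqP => ik; apply/N/F_fibre.
Qed.

(** Injectivity on [e_i A']: an element with zero image is zero in the orbit
    space, so the map of [orbit_section], which fixes it, kills it.
    Surjectivity: that map moves any preimage into [e_i A']. *)
Lemma covering_functor_of_quivers :
  @covering_functor K A' A (@rq_eps K Q') (@rq_eps K Q) F (rq_map F).
Proof.
split.
- exact: rq_map_lin.
- exact: rq_map_mul.
- exact: rq_map_eid.
- move=> i a ia Fa0; have [D [D_lin Did Dg _ _]] := orbit_section i.
  rewrite -(Did a ia).
  have /qprojP aS : orbit_class acta a = orbit_class acta 0.
    by apply: (bij_inj phi_bij); rewrite !phiE Fa0 (lin0 (rq_map_lin Frel)).
  rewrite -[a]subr0; apply: (aS (fun x => D x = 0)).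
    split=> [|x y Dx Dy|c x Dx]; first exact: lin0.
      by rewrite (linD D_lin) Dx Dy addr0.
    by rewrite (linZ D_lin) Dx scaler0.
  by move=> _ [g [x ->]]; rewrite (linB D_lin) Dg subrr.
- move=> i y iy; have [D [_ _ _ Di FD]] := orbit_section i.
  have [psi _ psiK] := phi_bij.
  exists (D (qrepr (psi y))) => //.
  by rewrite FD -phiE /orbit_class qreprK psiK.
- by move=> i a; exact: rq_map_eps.
- exact: F_onto.
move=> i k /F_fibre[g gk]; exists (act g), (acta g); split; last exact: gk.
split.
- by move=> j; apply/esym/F_fibre; exists g.
- exact: rq_map_deck.
- exact: (rq_map_left (fa_rel free _)).
- exact: (rq_map_right (fa_rel free _)).
move=> j l gj; have -> : g = 1%g; last exact: act1.
by apply: (@act_inj_group _ _ j); rewrite act1.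
Qed.

End CoveringQuivers.

Lemma covering_is_pseudo_frobenius (K : fieldType) (Q' Q : rquiver K)
    (F : qmorph Q' Q) :
  fin_dim (rq_algebra Q) -> split_basic (rq_algebra Q) ->
  self_injective (rq_algebra Q) -> is_covering F ->
  pseudo_frobenius (rq_algebra Q').
Proof.
move=> fd [lc _ _] si [Frel [G [act [free [onto fibre] [phi phiP]]]]].
have [_ phi_bij _ phiE] := phiP.
have aug := rq_eps_augmentation Q.
have loc := local_corners_augmented_local aug lc.
have [nu [w nuw]] := self_injective_nakayama_socle aug loc fd si.
have cf := covering_functor_of_quivers Frel free onto fibre phi_bij phiE.
exact: (covering_pseudo_frobenius cf aug (rq_eps_augmentation Q') loc fd nuw).
Qed.

Theorem corollary4p8 (K : fieldType) (Q : rquiver K)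
    (hfd : fin_dim (rq_algebra Q)) (hsb : split_basic (rq_algebra Q))
    (hsi : self_injective (rq_algebra Q)) :
  (forall (Qt : rquiver K) (F : qmorph Qt Q),
     is_universal_covering F -> pseudo_frobenius (rq_algebra Qt)) /\
  (forall (Q' : rquiver K) (F : qmorph Q' Q),
     is_covering F -> fin_dim (rq_algebra Q') ->
     self_injective (rq_algebra Q')).
Proof.
split=> [Qt F [Fcov _ _]|Q' F Fcov fd].
  exact: covering_is_pseudo_frobenius Fcov.
have [_ _ [f [nu ff]]] := covering_is_pseudo_frobenius hfd hsb hsi Fcov.
exact: nakayama_self_injective ff fd.
Qed.
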